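(* Let $F\in L^\infty\setminus\{0\}$ and let $u\in H^2$ be outer, such that $\ker T_F\neq\{0\}$ and $u\ker T_F\subseteq H^2$. Then $u\ker T_F=\ker T_{F\overline{u}/u}$ if and only if $u\in\mathcal{C}(\ker T_F)$ and $u^{-1}\in\mathcal{C}(\ker T_{F\overline{u}/u})$.
   Context: $\mathbb{T}$ is the unit circle with normalized Lebesgue measure, $L^\infty=L^\infty(\mathbb{T})$, $H^2$ is the Hardy space of the unit disc, regarded as a closed subspace of $L^2(\mathbb{T})$ via boundary values, and $P_{H^2}:L^2(\mathbb{T})\to H^2$ is the orthogonal projection. For $g\in L^\infty$ the Toeplitz operator is $T_g:H^2\to H^2$, $T_gf=P_{H^2}(gf)$. For a function $w$, $w\in\mathcal{C}(\ker T_g)$ means that $w\ker T_g\subseteq L^2(\mathbb{T})$ (in terms of boundary values). *)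

(* Defs.v *)
From HB Require Import structures.
From mathcomp Require Import all_boot all_order all_algebra.
From mathcomp Require Import complex.
From mathcomp Require Import all_classical all_reals all_analysis.

Set Implicit Arguments.
Unset Strict Implicit.
Unset Printing Implicit Defensive.

Import Order.TTheory GRing.Theory Num.Theory.
Import numFieldNormedType.Exports.

Local Open Scope classical_set_scope.
Local Open Scope ring_scope.
Local Open Scope complex_scope.

(* A function on the unit circle is represented by f : R -> R[i] through
   t |-> exp (2 i pi t). Only the values on [0, 1] matter, since
   [circle_measure] is carried by that interval. Elements of L^2, H^2 and
   ker T_g are measurable representatives, and all the sets of functions
   below that stand for subsets of L^2 are invariant under almost everywhere
   equality of measurable functions, so that equality of such sets is equality
   of sets of classes. *)

Section Circle.
Variable R : realType.

(* The modulus as an element of R: `|z| lives in R[i]. *)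
Definition cabs (z : R[i]) : R := Num.sqrt (complex.Re z ^+ 2 + complex.Im z ^+ 2).

Definition cexp (z : R[i]) : R[i] :=
  (expR (complex.Re z))%:C * (cos (complex.Im z) +i* sin (complex.Im z)).

Definition circle_point (t : R) : R[i] := cos (2 * pi * t) +i* sin (2 * pi * t).

Definition circle_measure : probability (measurableTypeR R) R :=
  uniform_prob (@ltr01 R).

Local Notation m := circle_measure.

Definition cmeasurable (f : R -> R[i]) : Prop :=
  measurable_fun [set: measurableTypeR R] (fun t => complex.Re (f t)) /\
  measurable_fun [set: measurableTypeR R] (fun t => complex.Im (f t)).

Definition cintegral (f : R -> R[i]) : R[i] :=
  (\int[m]_t complex.Re (f t)) +i* (\int[m]_t complex.Im (f t)).

Definition Lp (p : \bar R) : set (R -> R[i]) :=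
  [set f | cmeasurable f /\ finite_norm m p (fun t => cabs (f t))].

Definition inner (f g : R -> R[i]) : R[i] := cintegral (fun t => f t * conjc (g t)).

(* analytic on the unit disc, with Taylor coefficients a at 0 *)
Definition analytic_disc (U : R[i] -> R[i]) : Prop :=
  exists a : nat -> R[i], forall z : R[i], cabs z < 1 ->
    series (fun n => a n * z ^+ n : R[i]^o) @ \oo --> (U z : R[i]^o).

Definition hardy2_disc (U : R[i] -> R[i]) : Prop :=
  analytic_disc U /\
  exists M : R, forall r : R, 0 <= r < 1 ->
    (\int[m]_t ((cabs (U (r%:C * circle_point t)) ^+ 2)%:E) <= M%:E)%E.

Definition boundary_values (U : R[i] -> R[i]) (f : R -> R[i]) : Prop :=
  \forall t \ae m,
    (U (r%:C * circle_point t) : R[i]^o) @[r --> (1 : R)^'-] --> (f t : R[i]^o).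

Definition H2 : set (R -> R[i]) :=
  [set f | Lp 2%:E f /\ exists2 U, hardy2_disc U & boundary_values U f].

(* u is in H^2 and its disc function has the form
   U z = c exp (int (zeta + z) / (zeta - z) k(zeta) dm(zeta)), with |c| = 1 and
   k real and integrable (then k = log |u| almost everywhere). *)
Definition outer (u : R -> R[i]) : Prop :=
  exists2 U : R[i] -> R[i], hardy2_disc U /\ boundary_values U u &
  exists (c : R[i]) (k : R -> R),
    [/\ cabs c = 1,
        m.-integrable [set: measurableTypeR R] (fun t => (k t)%:E) &
        forall z : R[i], cabs z < 1 ->
          U z = c * cexp (cintegral (fun t =>
            (circle_point t + z) / (circle_point t - z) * (k t)%:C))].

Definition orthogonal_projection (V : set (R -> R[i])) (f p : R -> R[i]) : Prop :=
  V p /\ forall h, V h -> inner (f \- p) h = 0.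

(* The graph of T_g : the relation T_g f = p, for f in H^2. *)
Definition toeplitz (g f p : R -> R[i]) : Prop :=
  H2 f /\ orthogonal_projection H2 (g \* f) p.

Definition ker_toeplitz (g : R -> R[i]) : set (R -> R[i]) :=
  [set f | toeplitz g f (cst 0)].

(* w K *)
Definition mulset (w : R -> R[i]) (K : set (R -> R[i])) : set (R -> R[i]) :=
  [set h : R -> R[i] | cmeasurable h /\ exists2 f, K f & h = w \* f %[ae m]].

(* w \in C(K) *)
Definition multC (K : set (R -> R[i])) : set (R -> R[i]) :=
  [set w | mulset w K `<=` Lp 2%:E].

End Circle.

(* Main.v *)
(* The substance is Beurling's theorem for an outer function u in H^2, in dual
   form: if phi is in L^2 and phi u is orthogonal to all conjugated powers of
   zeta, i.e. int phi u zeta^n = 0 for n >= 0, then int phi = 0. Write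
   u = c exp (Herglotz integral of k), with |c| = 1, and let q be the outer
   function with log |q| = - max (k, - n). Then |q| <= e^n and |q u| <= 1 on the
   disc, while q u at 0 tends to c as n grows, so q u is close to c in L^2;
   moreover the dilates of q are uniform limits of polynomials Q, for which
   int phi Q u = 0. Hence int phi is arbitrarily small.

   Applied to the indicator function of {u = 0}, this shows that u is nonzero
   almost everywhere. If g is in H^2 and f = g / u in L^2, applied to
   zeta^n f (n >= 1) it shows that the negative Fourier coefficients of f
   vanish; the Cauchy transform of f is then the quotient of the disc functions
   of g and u, so f is in H^2. Finally, for g in the kernel of T_(F conj(u)/u)
   it transfers the orthogonality of (F conj(u)/u) g = F conj(u) f to H^2 into
   the orthogonality of F f to H^2. The opposite inclusion only uses that
   Taylor polynomials of u converge to u in L^2. *)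

Require Import Defs.
From HB Require Import structures.
From mathcomp Require Import all_boot all_order all_algebra.
From mathcomp Require Import complex.
From mathcomp Require Import all_classical all_reals all_analysis.
From mathcomp Require Import measurable_realfun ess_sup_inf ring lra.
Import Order.TTheory GRing.Theory Num.Theory.
Import numFieldNormedType.Exports.

Set Implicit Arguments.
Unset Strict Implicit.
Unset Printing Implicit Defensive.

Local Open Scope classical_set_scope.
Local Open Scope ring_scope.
Local Open Scope complex_scope.

(** * The complex modulus *)

(** The obstacle is that the outer function q is controlled only inside the disc, while the
    orthogonality lives on the circle. So [u] is replaced by a dilated Taylor polynomial p, and [Q]
    approximates the equally dilated q uniformly on the closed disc. The mean over the circle of the
    polynomial h = Q p is its value at 0. Two facts then make h close to c in L^2: |h| <= 1 + e
    everywhere, and a mean close to c, because |c - h|^2 = 1 + |h|^2 - 2 Re (conj(c) h). Cutting off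
    the logarithm at -n keeps q bounded, and its cost at 0 is only the integral of max (k, -n) - k,
    which dominated convergence makes small.

    The order of the choices matters: n comes first, then the radius, because the L^2 distance from
    [u] to p gets multiplied by the bound e^n + 1 on [Q], then [Q], and last the degree of p.

    On the boundary, norm estimates pass from the disc to the circle by Fatou's lemma along a
    sequence of radii, and the radial limits of a quotient are quotients of the given radial
    limits. *)

Section Modulus.
Variable R : realType.
Implicit Types (x y z : R[i]) (r : R).

Lemma normc_cabs z : `|z| = (cabs z)%:C.
Proof. exact: normc_def. Qed.

Lemma cabs_ge0 z : 0 <= cabs z.
Proof. exact: sqrtr_ge0. Qed.

Lemma sqr_cabs z : cabs z ^+ 2 = complex.Re z ^+ 2 + complex.Im z ^+ 2.
Proof. by rewrite sqr_sqrtr// addr_ge0// sqr_ge0. Qed.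

Lemma sqr_cabsE z : (cabs z ^+ 2)%:C = z * conjc z.
Proof.
rewrite sqr_cabs; case: z => a b /=; apply/eqP; rewrite eq_complex /=. 
by apply/andP; split; apply/eqP; ring.
Qed.

Lemma cabsM x y : cabs (x * y) = cabs x * cabs y.
Proof. by apply: (@complexI R); rewrite rmorphM/= -!normc_cabs normrM. Qed.

Lemma cabsV x : cabs x^-1 = (cabs x)^-1.
Proof. by apply: (@complexI R); rewrite fmorphV/= -!normc_cabs normfV. Qed.

Lemma cabsX x n : cabs (x ^+ n) = cabs x ^+ n.
Proof. by apply: (@complexI R); rewrite rmorphXn/= -!normc_cabs normrX. Qed.

Lemma cabsN x : cabs (- x) = cabs x.
Proof. by apply: (@complexI R); rewrite -!normc_cabs normrN. Qed.

Lemma cabsB x y : cabs (x - y) = cabs (y - x).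
Proof. by rewrite -cabsN opprB. Qed.

Lemma cabsD x y : cabs (x + y) <= cabs x + cabs y.
Proof. by rewrite -lecR rmorphD/= -!normc_cabs ler_normD. Qed.

Lemma cabsBD x y : cabs (x - y) <= cabs x + cabs y.
Proof. by rewrite -(cabsN y) cabsD. Qed.

Lemma cabs_dist x y z : cabs (x - z) <= cabs (x - y) + cabs (y - z).
Proof. by rewrite (_ : x - z = (x - y) + (y - z)) ?cabsD//; ring. Qed.

Lemma ler_dist_cabs x y : `|cabs x - cabs y| <= cabs (x - y).
Proof.
have h1 := cabsD (x - y) y; have h2 := cabsD (y - x) x.
by move: h1 h2; rewrite !subrK (cabsB y) ler_norml => h1 h2; apply/andP; split; lra.
Qed.

Lemma cabs_real r : cabs r%:C = `|r|.
Proof. by rewrite /cabs/= expr0n/= addr0 sqrtr_sqr. Qed.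

Lemma cabs0 : cabs (0 : R[i]) = 0.
Proof. by rewrite (_ : 0 = 0%:C)// cabs_real normr0. Qed.

Lemma cabs1 : cabs (1 : R[i]) = 1.
Proof. by rewrite (_ : 1 = 1%:C)// cabs_real normr1. Qed.

Lemma cabs_eq0 x : (cabs x == 0) = (x == 0).
Proof. by rewrite -(inj_eq (@complexI R)) -normc_cabs normr_eq0. Qed.

Lemma cabs_conj x : cabs (conjc x) = cabs x.
Proof. by case: x => a b; rewrite /cabs/= sqrrN. Qed.

Lemma ler_Re_cabs x : `|complex.Re x| <= cabs x.
Proof. by rewrite -sqrtr_sqr ler_wsqrtr// lerDl sqr_ge0. Qed.

Lemma ler_Im_cabs x : `|complex.Im x| <= cabs x.
Proof. by rewrite -sqrtr_sqr ler_wsqrtr// lerDr sqr_ge0. Qed.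

Lemma cabs_le_ReIm x : cabs x <= `|complex.Re x| + `|complex.Im x|.
Proof.
rewrite -(ler_pXn2r (n:=2))// ?nnegrE ?cabs_ge0 ?addr_ge0//.
rewrite sqr_cabs -[X in X + _ <= _]real_normK ?num_real//.
by rewrite -[X in _ + X <= _]real_normK ?num_real// sqrrD lerD2r lerDl mulrn_wge0 ?mulr_ge0.
Qed.

Lemma cabs_sum (I : Type) (s : seq I) (P : pred I) (f : I -> R[i]) :
  cabs (\sum_(i <- s | P i) f i) <= \sum_(i <- s | P i) cabs (f i).
Proof.
elim/big_rec2: _ => [|i a b _ h]; first by rewrite cabs0.
by rewrite (le_trans (cabsD _ _))// lerD2l.
Qed.

Lemma sqr_cabsD x y : cabs (x + y) ^+ 2 <= 2 * (cabs x ^+ 2 + cabs y ^+ 2).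
Proof.
have h : cabs (x + y) ^+ 2 <= (cabs x + cabs y) ^+ 2.
  by rewrite lerXn2r ?nnegrE ?addr_ge0 ?cabs_ge0 ?cabsD.
by apply: le_trans h _; rewrite -subr_ge0 (_ : _ - _ = (cabs x - cabs y) ^+ 2) ?sqr_ge0//; ring.
Qed.

Lemma cReD x y : complex.Re (x + y) = complex.Re x + complex.Re y.
Proof. by case: x; case: y. Qed.
Lemma cImD x y : complex.Im (x + y) = complex.Im x + complex.Im y.
Proof. by case: x; case: y. Qed.
Lemma cReN x : complex.Re (- x) = - complex.Re x.
Proof. by case: x. Qed.
Lemma cImN x : complex.Im (- x) = - complex.Im x.
Proof. by case: x. Qed.
Lemma cReM x y : complex.Re (x * y) =
  complex.Re x * complex.Re y - complex.Im x * complex.Im y.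
Proof. by case: x; case: y. Qed.
Lemma cImM x y : complex.Im (x * y) =
  complex.Re x * complex.Im y + complex.Im x * complex.Re y.
Proof. by case: x; case: y. Qed.
Lemma cReJ x : complex.Re (conjc x) = complex.Re x.
Proof. by case: x. Qed.
Lemma cImJ x : complex.Im (conjc x) = - complex.Im x.
Proof. by case: x. Qed.
Lemma complex_eq x y : complex.Re x = complex.Re y ->
  complex.Im x = complex.Im y -> x = y.
Proof. by case: x; case: y => a b c d /= -> ->. Qed.

(** The norm of [R[i]] takes its values in [R[i]], so the epsilons of the library are complex; a
    positive complex number is real, which reduces them to epsilons in [R]. *)
Lemma cvgcP (T : Type) (F : set_system T) {FF : Filter F} (f : T -> R[i])
    (l : R[i]) :
  (f x : R[i]^o) @[x --> F] --> (l : R[i]^o) <->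
  forall e : R, 0 < e -> \forall x \near F, cabs (f x - l) < e.
Proof.
split=> [/cvgrPdist_lt h e e0|h].
  have /h : (0 : R[i]) < e%:C by rewrite ltcR.
  by apply: filterS => x; rewrite normc_cabs ltcR cabsB.
apply/cvgrPdist_lt => e e0.
have -> : e = (complex.Re e)%:C by rewrite RRe_real// gtr0_real.
have e1 : 0 < complex.Re e by move: e0; rewrite ltcE => /andP[].
by apply: filterS (h _ e1) => x; rewrite normc_cabs ltcR cabsB.
Qed.

Lemma cvgc_div (T : Type) (F : set_system T) {FF : Filter F} (f g : T -> R[i])
    (a b : R[i]) : b != 0 ->
  (f x : R[i]^o) @[x --> F] --> (a : R[i]^o) ->
  (g x : R[i]^o) @[x --> F] --> (b : R[i]^o) ->
  (f x / g x : R[i]^o) @[x --> F] --> (a / b : R[i]^o).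
Proof.
move=> b0 fa gb; have gb' := @cvgV (R[i]) _ F FF g b b0 gb.
exact: (@cvgM (R[i]) _ F FF f (fun t => (g t)^-1) a b^-1 fa gb').
Qed.

End Modulus.
(** * Complex integrals on the circle *)

Section Integrals.
Variable R : realType.
Local Notation m := (circle_measure R).
Local Notation T := (measurableTypeR R).
Implicit Types (f g h : R -> R[i]) (c : R[i]).

Definition rintegrable (f : R -> R) : Prop :=
  m.-integrable [set: T] (fun t => (f t)%:E).

Definition cintegrable f : Prop :=
  rintegrable (fun t => complex.Re (f t)) /\ rintegrable (fun t => complex.Im (f t)).

(** Squared [L2] norm. [Rintegral] sends an infinite integral to 0, so a bound on [sqnorm f] says
    something only together with [L2 f]. *)
Definition sqnorm f : R := \int[m]_t (cabs (f t) ^+ 2).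

Definition L2 f : Prop := cmeasurable f /\ rintegrable (fun t => cabs (f t) ^+ 2).

Lemma aeS (P Q : R -> Prop) : (forall t, P t -> Q t) ->
  (\forall t \ae m, P t) -> \forall t \ae m, Q t.
Proof. by move=> PQ; apply: (@filterS _ _ (ae_filter_ringOfSetsType m)). Qed.

Lemma aeS2 (P1 P2 Q : R -> Prop) : (forall t, P1 t -> P2 t -> Q t) ->
  (\forall t \ae m, P1 t) -> (\forall t \ae m, P2 t) -> \forall t \ae m, Q t.
Proof. by move=> PQ; apply: (@filterS2 _ _ (ae_filter_ringOfSetsType m)). Qed.

Lemma aeT (P : R -> Prop) : (forall t, P t) -> \forall t \ae m, P t.
Proof. by move=> hP; apply: (@filterE _ _ (ae_filter_ringOfSetsType m)). Qed.

Lemma ae_eq_circleP (V : Type) (f g : R -> V) :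
  f = g %[ae m] <-> \forall t \ae m, f t = g t.
Proof. by split; apply: aeS => t; [apply|move=> + _]. Qed.

Lemma rintegrable_measurable (f : R -> R) : rintegrable f -> measurable_fun [set: T] f.
Proof. by move=> /measurable_int/measurable_EFinP. Qed.

Lemma rintegrableD (f g : R -> R) : rintegrable f -> rintegrable g ->
  rintegrable (fun t => f t + g t).
Proof. by move=> fi gi; have := integrableD measurableT fi gi. Qed.

Lemma rintegrableZ k (f : R -> R) : rintegrable f -> rintegrable (fun t => k * f t).
Proof. by move=> fi; have := integrableZl measurableT k fi. Qed.

Lemma rintegrableN (f : R -> R) : rintegrable f -> rintegrable (fun t => - f t).
Proof. by move=> fi; have := integrableN fi. Qed.

Lemma rintegrableB (f g : R -> R) : rintegrable f -> rintegrable g ->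
  rintegrable (fun t => f t - g t).
Proof. by move=> fi gi; apply: rintegrableD => //; exact: rintegrableN. Qed.

Lemma rintegrable_cst k : rintegrable (fun=> k).
Proof. exact: finite_measure_integrable_cst. Qed.

Lemma le_rintegrable (f g : R -> R) : measurable_fun [set: T] f ->
  (forall t, `|f t| <= g t) -> rintegrable g -> rintegrable f.
Proof.
move=> mf fg gi; apply: (le_integrable measurableT _ _ gi).
  exact/measurable_EFinP.
by move=> t _; rewrite /= lee_fin (le_trans (fg t))// ler_norm.
Qed.

Lemma rintegral_cst k : \int[m]_t k = k.
Proof. by rewrite Rintegral_cst//= probability_setT/= mulr1. Qed.

Lemma cmeasurableD f g : cmeasurable f -> cmeasurable g ->
  cmeasurable (fun t => f t + g t).
Proof.
move=> [f1 f2] [g1 g2]; split.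
  under eq_fun do rewrite cReD; exact: measurable_funD.
under eq_fun do rewrite cImD; exact: measurable_funD.
Qed.

Lemma cmeasurableM f g : cmeasurable f -> cmeasurable g ->
  cmeasurable (fun t => f t * g t).
Proof.
move=> [f1 f2] [g1 g2]; split.
  by under eq_fun do rewrite cReM; apply: measurable_funB; exact: measurable_funM.
by under eq_fun do rewrite cImM; apply: measurable_funD; exact: measurable_funM.
Qed.

Lemma cmeasurable_conj f : cmeasurable f -> cmeasurable (fun t => conjc (f t)).
Proof.
move=> [f1 f2]; split; first by under eq_fun do rewrite cReJ.
by under eq_fun do rewrite cImJ; apply: measurableT_comp.
Qed.

Lemma cmeasurable_real (f : R -> R) : measurable_fun [set: T] f ->
  cmeasurable (fun t => (f t)%:C).
Proof. by move=> mf; split => //=; exact: measurable_cst. Qed.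

Lemma cmeasurable_cst c : cmeasurable (fun _ : R => c).
Proof. by split; exact: measurable_cst. Qed.

Lemma cmeasurableN f : cmeasurable f -> cmeasurable (fun t => - f t).
Proof.
move=> mf; under eq_fun do rewrite -mulN1r.
exact: cmeasurableM (cmeasurable_cst _) mf.
Qed.

Lemma cmeasurableB f g : cmeasurable f -> cmeasurable g ->
  cmeasurable (fun t => f t - g t).
Proof. by move=> mf mg; apply: cmeasurableD => //; exact: cmeasurableN. Qed.

Lemma measurable_cabs f : cmeasurable f -> measurable_fun [set: T] (fun t => cabs (f t)).
Proof.
move=> [f1 f2]; rewrite /cabs.
apply: (@measurableT_comp _ _ _ _ _ _ (@Num.sqrt R)).
  by apply: continuous_measurable_fun => x; exact: sqrt_continuous.
by apply: measurable_funD; exact: measurable_funX.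
Qed.

Lemma cmeasurableV f : cmeasurable f -> cmeasurable (fun t => (f t)^-1).
Proof.
move=> mf.
(* The inverse of the squared modulus is written as a real power, whose measurability is available.
   Both sides are 0 where [f] vanishes. *)
have -> : (fun t => (f t)^-1) = (fun t => conjc (f t) * ((cabs (f t) ^+ 2) `^ (-1))%:C).
  apply/funext => t; rewrite powR_inv1 ?sqr_ge0// fmorphV/= sqr_cabsE.
  have [->|f0] := eqVneq (f t) 0; first by rewrite rmorph0 !mul0r invr0.
  by rewrite invfM mulrCA mulfV ?mulr1// conjc_eq0.
apply: cmeasurableM; first exact: cmeasurable_conj.
apply: cmeasurable_real; apply: (measurableT_comp (@measurable_powR R (-1))).
by apply: measurable_funX; exact: measurable_cabs.
Qed.

Lemma cmeasurable_sum (I : Type) (s : seq I) (F : I -> R -> R[i]) :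
  (forall i, cmeasurable (F i)) -> cmeasurable (fun t => \sum_(i <- s) F i t).
Proof.
move=> mF; elim: s => [|i s ih].
  by under eq_fun do rewrite big_nil; exact: cmeasurable_cst.
by under eq_fun do rewrite big_cons; exact: cmeasurableD.
Qed.

Lemma cmeasurable_circle_point : cmeasurable (@circle_point R).
Proof.
have ml : measurable_fun [set: T] (fun t : R => 2 * pi * t).
  by apply: measurable_funM => //; exact: measurable_cst.
split => /=.
  apply: (measurableT_comp _ ml).
  by apply: continuous_measurable_fun => x; exact: continuous_cos.
apply: (measurableT_comp _ ml).
by apply: continuous_measurable_fun => x; exact: continuous_sin.
Qed.

Lemma cmeasurableX f n : cmeasurable f -> cmeasurable (fun t => f t ^+ n).
Proof.
move=> mf; elim: n => [|n ih].
  by under eq_fun do rewrite expr0; exact: cmeasurable_cst.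
by under eq_fun do rewrite exprS; exact: cmeasurableM.
Qed.

Lemma cmeasurable_cvg (f_ : nat -> R -> R[i]) f : (forall n, cmeasurable (f_ n)) ->
  (forall t (e : R), 0 < e -> \forall n \near \oo, cabs (f_ n t - f t) < e) ->
  cmeasurable f.
Proof.
move=> mf cf; split.
  apply: (measurable_fun_cvg (fun n => (mf n).1)) => t _.
  apply/cvgrPdist_lt => e e0; apply: filterS (cf t _ e0) => n.
  by apply: le_lt_trans; rewrite distrC -cReN -cReD ler_Re_cabs.
apply: (measurable_fun_cvg (fun n => (mf n).2)) => t _.
apply/cvgrPdist_lt => e e0; apply: filterS (cf t _ e0) => n.
by apply: le_lt_trans; rewrite distrC -cImN -cImD ler_Im_cabs.
Qed.

Lemma cintegrable_measurable f : cintegrable f -> cmeasurable f.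
Proof. by move=> [/rintegrable_measurable ? /rintegrable_measurable ?]. Qed.

Lemma le_cintegrable f (g : R -> R) : cmeasurable f ->
  (forall t, cabs (f t) <= g t) -> rintegrable g -> cintegrable f.
Proof.
move=> [f1 f2] fg gi; split.
  by apply: (le_rintegrable f1 _ gi) => t; exact: le_trans (ler_Re_cabs _) (fg t).
by apply: (le_rintegrable f2 _ gi) => t; exact: le_trans (ler_Im_cabs _) (fg t).
Qed.

Lemma cintegrable_cabs f : cintegrable f -> rintegrable (fun t => cabs (f t)).
Proof.
move=> [f1 f2].
apply: (@le_rintegrable _ (fun t => `|complex.Re (f t)| + `|complex.Im (f t)|)).
- by apply: measurable_cabs; exact: cintegrable_measurable.
- by move=> t; rewrite ger0_norm ?cabs_ge0 ?cabs_le_ReIm.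
- by apply: rintegrableD; exact: integrable_norm.
Qed.

Lemma cintegrable_cst c : cintegrable (fun=> c).
Proof. by split; exact: rintegrable_cst. Qed.

Lemma cintegrableD f g : cintegrable f -> cintegrable g ->
  cintegrable (fun t => f t + g t).
Proof.
move=> [f1 f2] [g1 g2]; rewrite /cintegrable.
under eq_fun do rewrite cReD; under [in X in _ /\ X]eq_fun do rewrite cImD.
by split; exact: rintegrableD.
Qed.

Lemma cintegrableZ c f : cintegrable f -> cintegrable (fun t => c * f t).
Proof.
move=> [f1 f2]; rewrite /cintegrable.
under eq_fun do rewrite cReM; under [in X in _ /\ X]eq_fun do rewrite cImM.
by split; [apply: rintegrableB|apply: rintegrableD]; exact: rintegrableZ.
Qed.

Lemma cintegrableN f : cintegrable f -> cintegrable (fun t => - f t).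
Proof. by move=> fi; under eq_fun do rewrite -mulN1r; exact: cintegrableZ. Qed.

Lemma cintegrable_real (f : R -> R) : rintegrable f -> cintegrable (fun t => (f t)%:C).
Proof. by move=> fi; split => //=; exact: rintegrable_cst. Qed.

Lemma cintegrable_sum (I : Type) (s : seq I) (F : I -> R -> R[i]) :
  (forall i, cintegrable (F i)) -> cintegrable (fun t => \sum_(i <- s) F i t).
Proof.
move=> iF; elim: s => [|i s ih].
  by under eq_fun do rewrite big_nil; exact: cintegrable_cst.
by under eq_fun do rewrite big_cons; exact: cintegrableD.
Qed.

Lemma cintegralD f g : cintegrable f -> cintegrable g ->
  cintegral (fun t => f t + g t) = cintegral f + cintegral g.
Proof.
move=> [f1 f2] [g1 g2]; apply: complex_eq => /=.
  by under eq_Rintegral do rewrite cReD; rewrite RintegralD.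
by under eq_Rintegral do rewrite cImD; rewrite RintegralD.
Qed.

Lemma cintegralZ c f : cintegrable f -> cintegral (fun t => c * f t) = c * cintegral f.
Proof.
move=> [f1 f2]; apply: complex_eq.
  rewrite cReM /=; under eq_Rintegral do rewrite cReM.
  by rewrite RintegralB ?RintegralZl//; exact: rintegrableZ.
rewrite cImM /=; under eq_Rintegral do rewrite cImM.
by rewrite RintegralD ?RintegralZl//; exact: rintegrableZ.
Qed.

Lemma cintegralN f : cintegrable f -> cintegral (fun t => - f t) = - cintegral f.
Proof.
by move=> fi; rewrite -mulN1r -cintegralZ//; congr cintegral; apply/funext => t; rewrite mulN1r.
Qed.

Lemma cintegralB f g : cintegrable f -> cintegrable g ->
  cintegral (fun t => f t - g t) = cintegral f - cintegral g.
Proof.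
by move=> fi gi; rewrite cintegralD ?cintegralN//; exact: cintegrableN.
Qed.

Lemma cintegral_cst c : cintegral (fun=> c) = c.
Proof. by apply: complex_eq; rewrite /= rintegral_cst. Qed.

Lemma cintegral_conj f : cintegrable f ->
  cintegral (fun t => conjc (f t)) = conjc (cintegral f).
Proof.
move=> [f1 f2]; apply: complex_eq.
  by rewrite cReJ /=; under eq_Rintegral do rewrite cReJ.
rewrite cImJ /=; under eq_Rintegral do rewrite cImJ -mulN1r.
by rewrite RintegralZl// mulN1r.
Qed.

Lemma cintegral_real (f : R -> R) : cintegral (fun t => (f t)%:C) = (\int[m]_t f t)%:C.
Proof. by apply: complex_eq => //=; rewrite rintegral_cst. Qed.

Lemma cintegral_sum (I : Type) (s : seq I) (F : I -> R -> R[i]) :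
  (forall i, cintegrable (F i)) ->
  cintegral (fun t => \sum_(i <- s) F i t) = \sum_(i <- s) cintegral (F i).
Proof.
move=> iF; elim: s => [|i s ih].
  by under eq_fun do rewrite big_nil; rewrite cintegral_cst big_nil.
under eq_fun do rewrite big_cons; rewrite big_cons cintegralD ?ih//.
exact: cintegrable_sum.
Qed.

Lemma ae_eq_cintegral f g : cmeasurable f -> cmeasurable g -> f = g %[ae m] ->
  cintegral f = cintegral g.
Proof.
move=> [f1 f2] [g1 g2] fg; apply: complex_eq; rewrite /= /Rintegral; congr fine.
  apply: ae_eq_integral => //; [exact/measurable_EFinP..|].
  by apply: aeS fg => t h /h ->.
apply: ae_eq_integral => //; [exact/measurable_EFinP..|].
by apply: aeS fg => t h /h ->.
Qed.

Lemma le_rintegral (f g : R -> R) : rintegrable f -> rintegrable g ->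
  (forall t, f t <= g t) -> \int[m]_t f t <= \int[m]_t g t.
Proof. by move=> fi gi fg; apply: le_Rintegral. Qed.

(** Rotation to the real axis: with [I] the integral, [cabs I ^+ 2] is the integral of the real part
    of [conjc I * f], hence at most [cabs I] times the integral of [cabs f]. *)
Lemma le_cabs_cintegral f : cintegrable f ->
  cabs (cintegral f) <= \int[m]_t cabs (f t).
Proof.
move=> fi; set I := cintegral f.
have [->|I0] := eqVneq I 0.
  by rewrite cabs0 Rintegral_ge0// => t _; exact: cabs_ge0.
have I0' : 0 < cabs I by rewrite lt_neqAle cabs_ge0 andbT eq_sym cabs_eq0.
have Ji : cintegrable (fun t => conjc I * f t) by exact: cintegrableZ.
have h : cabs I ^+ 2 = \int[m]_t complex.Re (conjc I * f t).
  have -> : \int[m]_t complex.Re (conjc I * f t) =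
    complex.Re (cintegral (fun t => conjc I * f t)) by [].
  by rewrite cintegralZ// mulrC -sqr_cabsE.
rewrite -(ler_pM2l I0') -expr2 h -RintegralZl//; last exact: cintegrable_cabs.
apply: le_rintegral; [exact: Ji.1|exact/rintegrableZ/cintegrable_cabs|move=> t].
by rewrite (le_trans (ler_norm _))// (le_trans (ler_Re_cabs _))// cabsM cabs_conj.
Qed.

End Integrals.
(** * Square integrable functions *)

Section SquareIntegrable.
Variable R : realType.
Local Notation m := (circle_measure R).
Local Notation T := (measurableTypeR R).
Implicit Types (f g h : R -> R[i]) (c : R[i]).

Lemma measurable_sqr_cabs f : cmeasurable f ->
  measurable_fun [set: T] (fun t => cabs (f t) ^+ 2).
Proof. by move=> mf; apply: measurable_funX; exact: measurable_cabs. Qed.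

Lemma finite_norm2P (f : R -> R) : measurable_fun [set: T] f ->
  finite_norm m 2%:E f <-> rintegrable (fun t => f t ^+ 2).
Proof.
move=> mf; split=> fi.
  by apply: Lfun2_integrable_sqr; rewrite inE; apply/andP; split; rewrite inE.
rewrite /finite_norm unlock; apply: poweR_lty.
move/integrableP : fi => [_]; congr (_ < _)%E; apply: eq_integral => t _.
by rewrite /= powR_mulrn// ger0_norm ?sqr_ge0// real_normK ?num_real.
Qed.

Lemma LpP f : Lp 2%:E f <-> L2 f.
Proof.
by split=> -[mf fi]; split => //; apply/finite_norm2P => //; exact: measurable_cabs.
Qed.

Lemma le_L2 f (g : R -> R) : cmeasurable f -> (forall t, cabs (f t) ^+ 2 <= g t) ->
  rintegrable g -> L2 f.
Proof.
move=> mf fg gi; split=> //; apply: (le_rintegrable _ _ gi).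
  exact: measurable_sqr_cabs.
by move=> t; rewrite ger0_norm ?sqr_ge0.
Qed.

Lemma L2D f g : L2 f -> L2 g -> L2 (fun t => f t + g t).
Proof.
move=> [mf fi] [mg gi]; have := rintegrableZ 2 (rintegrableD fi gi).
by apply: le_L2 => [|t]; [exact: cmeasurableD|exact: sqr_cabsD].
Qed.

Lemma L2M_bounded (C : R) f g : cmeasurable f -> (forall t, cabs (f t) <= C) ->
  L2 g -> L2 (fun t => f t * g t).
Proof.
move=> mf fC [mg gi]; have := rintegrableZ (C ^+ 2) gi.
apply: le_L2 => [|t]; first exact: cmeasurableM.
rewrite cabsM exprMn ler_wpM2r ?sqr_ge0// lerXn2r ?nnegrE ?cabs_ge0//.
by rewrite (le_trans _ (fC t))// cabs_ge0.
Qed.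

Lemma L2Z c f : L2 f -> L2 (fun t => c * f t).
Proof. by apply: (@L2M_bounded (cabs c)) => //; exact: cmeasurable_cst. Qed.

Lemma L2N f : L2 f -> L2 (fun t => - f t).
Proof. by move=> fi; under eq_fun do rewrite -mulN1r; exact: L2Z. Qed.

Lemma L2B f g : L2 f -> L2 g -> L2 (fun t => f t - g t).
Proof. by move=> fi gi; apply: L2D => //; exact: L2N. Qed.

Lemma L2_conj f : L2 f -> L2 (fun t => conjc (f t)).
Proof.
by move=> [mf fi]; split; [exact: cmeasurable_conj|under eq_fun do rewrite cabs_conj].
Qed.

Lemma L2_bounded (C : R) f : cmeasurable f -> (forall t, cabs (f t) <= C) -> L2 f.
Proof.
move=> mf fC; apply: (le_L2 mf _ (rintegrable_cst (C ^+ 2))) => t.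
by rewrite lerXn2r ?nnegrE ?cabs_ge0// (le_trans _ (fC t))// cabs_ge0.
Qed.

Lemma L2_cst c : L2 (fun _ : R => c).
Proof. by apply: (@L2_bounded (cabs c)) => //; exact: cmeasurable_cst. Qed.

Lemma rintegrableM (f g : R -> R) :
  measurable_fun [set: T] f -> measurable_fun [set: T] g ->
  rintegrable (fun t => f t ^+ 2) -> rintegrable (fun t => g t ^+ 2) ->
  rintegrable (fun t => f t * g t).
Proof.
move=> mf mg fi gi; have := rintegrableD fi gi.
apply: le_rintegrable => [|t]; first exact: measurable_funM.
have := sqr_ge0 (f t - g t); have := sqr_ge0 (f t + g t).
by rewrite ler_norml => h1 h2; apply/andP; split; nra.
Qed.

(** The integral of [(s * f - g) ^+ 2] is nonnegative for every [s]; the inequality is its value at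
    the minimum [s = B / A]. *)
Lemma rintegral_cauchy_schwarz (f g : R -> R) :
  measurable_fun [set: T] f -> measurable_fun [set: T] g ->
  rintegrable (fun t => f t ^+ 2) -> rintegrable (fun t => g t ^+ 2) ->
  (\int[m]_t (f t * g t)) ^+ 2 <= \int[m]_t (f t ^+ 2) * \int[m]_t (g t ^+ 2).
Proof.
move=> mf mg fi gi; have fgi := rintegrableM mf mg fi gi.
set B := \int[m]_t (f t * g t); set A := \int[m]_t (f t ^+ 2).
set C := \int[m]_t (g t ^+ 2).
have A0 : 0 <= A by apply: Rintegral_ge0 => t _; exact: sqr_ge0.
have C0 : 0 <= C by apply: Rintegral_ge0 => t _; exact: sqr_ge0.
have q s : 0 <= s ^+ 2 * A - 2 * s * B + C.
  have : 0 <= \int[m]_t (s ^+ 2 * f t ^+ 2 - 2 * s * (f t * g t) + g t ^+ 2).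
    apply: Rintegral_ge0 => t _.
    by rewrite (_ : _ + _ = (s * f t - g t) ^+ 2) ?sqr_ge0//; ring.
  rewrite RintegralD ?RintegralB ?RintegralZl//; try exact: rintegrableZ.
  by apply: rintegrableB; exact: rintegrableZ.
(* With [A = 0] the quadratic is affine in [s]; for nonzero [B] the choice [s = (C + 1) / (2 * B)]
   would give it the value -1. *)
have [A00|A1] := eqVneq A 0.
  have [->|B0] := eqVneq B 0; first by rewrite expr0n/= mulr_ge0.
  have := q ((C + 1) / (2 * B)); rewrite A00.
  suff -> : ((C + 1) / (2 * B)) ^+ 2 * 0 - 2 * ((C + 1) / (2 * B)) * B + C = -1 by lra.
  by field.
have Ap : 0 < A by rewrite lt_neqAle eq_sym A1.
have := q (B / A).
have -> : (B / A) ^+ 2 * A - 2 * (B / A) * B + C = (A * C - B ^+ 2) / A by field.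
by rewrite pmulr_lge0 ?invr_gt0// subr_ge0.
Qed.

Lemma sqnorm_ge0 f : 0 <= sqnorm f.
Proof. by apply: Rintegral_ge0 => t _; exact: sqr_ge0. Qed.

Lemma cintegrableM f g : L2 f -> L2 g -> cintegrable (fun t => f t * g t).
Proof.
move=> [mf fi] [mg gi].
apply: (@le_cintegrable _ _ (fun t => cabs (f t) * cabs (g t))).
- exact: cmeasurableM.
- by move=> t; rewrite cabsM.
- by apply: rintegrableM => //; exact: measurable_cabs.
Qed.

Lemma cintegrable_L2 f : L2 f -> cintegrable f.
Proof.
by move=> /cintegrableM/(_ (L2_cst 1)); under eq_fun do rewrite mulr1.
Qed.

Lemma cauchy_schwarz f g : L2 f -> L2 g ->
  cabs (cintegral (fun t => f t * g t)) ^+ 2 <= sqnorm f * sqnorm g.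
Proof.
move=> Lf Lg; have [mf fi] := Lf; have [mg gi] := Lg.
have := rintegral_cauchy_schwarz (measurable_cabs mf) (measurable_cabs mg) fi gi.
apply: le_trans; rewrite lerXn2r ?nnegrE ?cabs_ge0//.
  by apply: Rintegral_ge0 => t _; rewrite mulr_ge0 ?cabs_ge0.
rewrite (le_trans (le_cabs_cintegral (cintegrableM Lf Lg)))//.
by under eq_Rintegral do rewrite cabsM.
Qed.

Lemma sqnormD f g : L2 f -> L2 g ->
  sqnorm (fun t => f t + g t) <= 2 * (sqnorm f + sqnorm g).
Proof.
move=> Lf Lg; rewrite /sqnorm -RintegralD ?Lf.2 ?Lg.2//.
rewrite -RintegralZl//; last exact: rintegrableD Lf.2 Lg.2.
apply: le_rintegral; first exact: (L2D Lf Lg).2.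
  exact: rintegrableZ (rintegrableD Lf.2 Lg.2).
by move=> t; exact: sqr_cabsD.
Qed.

Lemma le_sqnormM (C : R) f g : cmeasurable f -> (forall t, cabs (f t) <= C) ->
  L2 g -> sqnorm (fun t => f t * g t) <= C ^+ 2 * sqnorm g.
Proof.
move=> mf fC Lg; rewrite /sqnorm -RintegralZl//; last exact: Lg.2.
apply: le_rintegral; first exact: (L2M_bounded mf fC Lg).2.
  exact: rintegrableZ Lg.2.
move=> t; rewrite cabsM exprMn ler_wpM2r ?sqr_ge0//.
by rewrite lerXn2r ?nnegrE ?cabs_ge0// (le_trans _ (fC t))// cabs_ge0.
Qed.

Lemma le_sqnorm_cst (C : R) f : cmeasurable f -> (forall t, cabs (f t) <= C) ->
  sqnorm f <= C ^+ 2.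
Proof.
move=> mf fC; rewrite -[leRHS]rintegral_cst.
apply: le_rintegral; [exact: (L2_bounded mf fC).2|exact: rintegrable_cst|move=> t].
by rewrite lerXn2r ?nnegrE ?cabs_ge0// (le_trans _ (fC t))// cabs_ge0.
Qed.

Lemma sqnormN f : sqnorm (fun t => - f t) = sqnorm f.
Proof. by apply: eq_Rintegral => t _; rewrite cabsN. Qed.

Lemma sqnorm_conj f : sqnorm (fun t => conjc (f t)) = sqnorm f.
Proof. by apply: eq_Rintegral => t _; rewrite cabs_conj. Qed.

Lemma sqnormE f : (sqnorm f)%:C = cintegral (fun t => f t * conjc (f t)).
Proof.
by rewrite /sqnorm -cintegral_real; congr cintegral; apply/funext => t; rewrite sqr_cabsE.
Qed.

(** Carries norm bounds on dilated polynomials over to the boundary function in [H2_approx]. *)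
Lemma sqnorm_fatou (f_ : nat -> R -> R[i]) f (C : R) :
  cmeasurable f -> (forall n, L2 (f_ n)) -> (forall n, sqnorm (f_ n) <= C) ->
  (\forall t \ae m, forall e : R, 0 < e -> \forall n \near \oo, cabs (f_ n t - f t) < e) ->
  L2 f /\ sqnorm f <= C.
Proof.
move=> mf Lf_ f_C cf.
have mE g : cmeasurable g -> measurable_fun [set: T] (fun t => (cabs (g t) ^+ 2)%:E).
  by move=> mg; apply/measurable_EFinP; exact: measurable_sqr_cabs.
have h : (\int[m]_t ((cabs (f t) ^+ 2)%:E) <= C%:E)%E.
  have /= := @fatou _ _ _ m _ measurableT
    (fun n t => (cabs (f_ n t) ^+ 2)%:E) (fun n => mE _ (Lf_ n).1)
    (fun n t _ => sqr_ge0 _).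
  have -> : (\int[m]_x limn_einf (fun n => (cabs (f_ n x) ^+ 2)%:E) =
      \int[m]_t (cabs (f t) ^+ 2)%:E)%E.
    apply: ae_eq_integral => //; last first.
      apply: aeS cf => t ct _.
      suff : (cabs (f_ n t) ^+ 2)%:E @[n --> \oo] --> (cabs (f t) ^+ 2)%:E.
        by move=> /[dup] /cvgP c /cvg_lim <-//; rewrite is_cvg_limn_einfE.
      apply: cvg_EFin; first by near=> n.
      apply: (@cvg_comp _ _ _ (fun n => cabs (f_ n t)) (fun x => x ^+ 2) _ (nbhs (cabs (f t)))).
        apply/cvgrPdist_lt => e e0; apply: filterS (ct _ e0) => n; apply: le_lt_trans.
        by rewrite cabsB ler_dist_cabs.
      exact: exprn_continuous.
    - exact: mE.
    - rewrite /limn_einf; apply: measurableT_comp => //.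
      apply: measurable_fun_limn_esup => n /=.
      apply/measurable_EFinP; apply: measurableT_comp => //.
      exact: measurable_sqr_cabs (Lf_ n).1.
  move=> /le_trans; apply.
  rewrite limn_einf_lim; apply: lime_le; first exact: is_cvg_einfs.
  near=> n; apply: (@le_trans _ _ (\int[m]_t (cabs (f_ n t) ^+ 2)%:E)%E).
    by apply: ereal_inf_lbound; exists n => /=.
  rewrite -(@fineK _ (\int[m]_t _)%E) ?lee_fin ?f_C//.
  exact: integrable_fin_num (Lf_ n).2.
have Lf : L2 f.
  split=> //; apply/integrableP; split; first exact: mE.
  apply: le_lt_trans (ltry C); apply: le_trans h.
  by under eq_integral do rewrite gee0_abs ?lee_fin ?sqr_ge0//.
split=> //; rewrite -lee_fin /sqnorm /Rintegral fineK//.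
exact: integrable_fin_num Lf.2.
Unshelve. all: by end_near. Qed.

End SquareIntegrable.
(** * Polynomials on the circle *)

Section CirclePolynomials.
Variable R : realType.
Local Notation m := (circle_measure R).
Local Notation T := (measurableTypeR R).
Local Notation cp := (@circle_point R).
Implicit Types (f g h : R -> R[i]) (c : R[i]) (p q : {poly R[i]}).

Lemma ge0_integral_derivative (f F : R -> R) : continuous f ->
  (forall x : R, is_derive x 1 F (f x)) -> (forall x, 0 <= f x) ->
  (\int[m]_t (f t)%:E = (F 1 - F 0)%:E)%E.
Proof.
move=> cf dF f0; rewrite integral_uniform//; last first.
  by apply/measurable_EFinP; exact: continuous_measurable_fun.
have cF : continuous F.
  by move=> x; apply: differentiable_continuous; apply/derivable1_diffP; case: (dF x).
rewrite (@continuous_FTC2 _ f F)//.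
- by rewrite subr0 invr1 mul1e EFinB.
- by apply: continuous_subspaceT.
- split.
  + by move=> x _; case: (dF x).
  + by apply: cvg_at_right_filter; exact: cF.
  + by apply: cvg_at_left_filter; exact: cF.
- by move=> x _; rewrite derive1E; case: (dF x).
Qed.

Lemma sin_natmul2pi n : sin (2 * pi * n%:R : R) = 0 /\ cos (2 * pi * n%:R : R) = 1.
Proof.
elim: n => [|n [ihs ihc]]; first by rewrite mulr0 sin0 cos0.
have -> : 2 * pi * n.+1%:R = 2 * pi * n%:R + pi *+ 2 :> R by rewrite -natr1; ring.
rewrite sinD (cosD (_ * _)) ihs ihc sin2pi cos2pi.
by split; ring.
Qed.

Lemma rintegrable_bounded (C : R) (f : R -> R) : measurable_fun [set: T] f ->
  (forall t, `|f t| <= C) -> rintegrable f.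
Proof. by move=> mf fC; exact: le_rintegrable (rintegrable_cst C). Qed.

Lemma rintegral_derivative (f F : R -> R) : continuous f ->
  (forall x : R, is_derive x 1 F (f x)) -> (forall x, `|f x| <= 1) ->
  \int[m]_t f t = F 1 - F 0.
Proof.
move=> cf dF f1.
have fi : rintegrable f.
  by apply: rintegrable_bounded f1; exact: continuous_measurable_fun.
(* Adding 1 makes the integrand nonnegative, as [ge0_integral_derivative] requires, and adds [x] to
   the primitive. *)
have : (\int[m]_t (1 + f t)%:E = (1 + F 1 - (0 + F 0))%:E)%E.
  apply: (@ge0_integral_derivative _ (fun x => x + F x)) => x.
  - by apply: cvgD; [exact: cvg_cst|exact: cf].
  - by have := f1 x; rewrite ler_norml => /andP[]; lra.
have -> : (\int[m]_t (1 + f t)%:E = (\int[m]_t (1 + f t))%:E)%E.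
  by rewrite fineK//; apply: integrable_fin_num => //; exact: rintegrableD (rintegrable_cst 1) fi.
move=> [].
by rewrite RintegralD ?rintegral_cst//; [lra|exact: rintegrable_cst].
Qed.

Lemma circle_pointX t n :
  cp t ^+ n = cos (2 * pi * n%:R * t) +i* sin (2 * pi * n%:R * t).
Proof.
elim: n => [|n ih]; first by rewrite expr0 mulr0 mul0r cos0 sin0.
have -> : 2 * pi * n.+1%:R * t = 2 * pi * t + 2 * pi * n%:R * t :> R.
  by rewrite -natr1; ring.
rewrite exprS ih sinD cosD; apply: complex_eq; rewrite ?cReM ?cImM /=; ring.
Qed.

Lemma cabs_circle_point t : cabs (cp t) = 1.
Proof.
by rewrite /cabs /= cos2Dsin2 sqrtr1.
Qed.

Lemma circle_point_neq0 t : cp t != 0.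
Proof. by rewrite -cabs_eq0 cabs_circle_point oner_eq0. Qed.

Lemma circle_pointJ t : cp t * conjc (cp t) = 1.
Proof. by rewrite -sqr_cabsE cabs_circle_point expr1n. Qed.

Lemma cintegral_circle_pointX n : cintegral (fun t => cp t ^+ n) = (n == 0%N)%:R.
Proof.
have [->|n0] := eqVneq n 0%N.
  by under eq_fun do rewrite expr0; rewrite cintegral_cst.
under eq_fun do rewrite circle_pointX.
set k : R := 2 * pi * n%:R.
have k0 : k != 0 by rewrite mulf_neq0 ?mulf_neq0 ?pnatr_eq0// gt_eqF// pi_gt0.
have [sk ck] := sin_natmul2pi n.
have ckl : continuous (fun x : R => k * x).
  by move=> x; apply: cvgM; [exact: cvg_cst|exact: cvg_id].
have ds (x : R) : is_derive x 1 (fun x => k^-1 * sin (k * x)) (cos (k * x)).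
  apply: is_derive_eq; rewrite /GRing.scale /=.
  by field.
have dc (x : R) : is_derive x 1 (fun x => - k^-1 * cos (k * x)) (sin (k * x)).
  apply: is_derive_eq; rewrite /GRing.scale /=.
  by field.
apply: complex_eq => /=.
  rewrite (rintegral_derivative _ ds) => [||x]; last exact: cos_max.
    by rewrite mulr1 mulr0 sin0 sk; ring.
  by move=> x; apply: continuous_comp; [exact: ckl|exact: continuous_cos].
rewrite (rintegral_derivative _ dc) => [||x]; last exact: sin_max.
  by rewrite mulr1 mulr0 cos0 ck; ring.
by move=> x; apply: continuous_comp; [exact: ckl|exact: continuous_sin].
Qed.

Lemma cintegral_circle_point_conj i j :
  cintegral (fun t => cp t ^+ j * conjc (cp t ^+ i)) = (i == j)%:R.
Proof.
wlog ij : i j / (i <= j)%N => [hw|].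
  have [/hw//|/ltnW ji] := leqP i j.
  rewrite eq_sym -[RHS]conjc_nat -hw// -cintegral_conj; last first.
    apply: cintegrable_L2; apply: (@L2_bounded _ 1).
      apply: cmeasurableM; last apply: cmeasurable_conj; 
      by apply: cmeasurableX; exact: cmeasurable_circle_point.
    by move=> t; rewrite cabsM cabs_conj !cabsX !cabs_circle_point !expr1n mulr1.
  by congr cintegral; apply/funext => t; rewrite rmorphM /= conjcK mulrC.
have -> : (fun t => cp t ^+ j * conjc (cp t ^+ i)) = fun t => cp t ^+ (j - i).
  apply/funext => t; rewrite -{1}(subnK ij) exprD -mulrA rmorphXn/= -exprMn.
  by rewrite circle_pointJ expr1n mulr1.
by rewrite cintegral_circle_pointX subn_eq0 eqn_leq ij.
Qed.

Definition coef_norm1 p : R := \sum_(i < size p) cabs p`_i.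

Lemma cabs_horner p z : cabs z <= 1 -> cabs p.[z] <= coef_norm1 p.
Proof.
move=> z1; rewrite horner_coef (le_trans (cabs_sum _ _ _))//.
apply: ler_sum => i _; rewrite cabsM cabsX ler_piMr ?cabs_ge0//.
by rewrite exprn_ile1 ?cabs_ge0.
Qed.

Lemma cmeasurable_poly p f : cmeasurable f -> cmeasurable (fun t => p.[f t]).
Proof.
move=> mf; under eq_fun do rewrite horner_coef.
apply: cmeasurable_sum => i; apply: cmeasurableM; first exact: cmeasurable_cst.
exact: cmeasurableX.
Qed.

Lemma cmeasurable_poly_circle p : cmeasurable (fun t => p.[cp t]).
Proof. by apply: cmeasurable_poly; exact: cmeasurable_circle_point. Qed.

Lemma cabs_poly_circle p t : cabs p.[cp t] <= coef_norm1 p.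
Proof. by rewrite cabs_horner// cabs_circle_point. Qed.

Lemma L2_poly p : L2 (fun t => p.[cp t]).
Proof. exact: L2_bounded (cmeasurable_poly_circle p) (cabs_poly_circle p). Qed.

Lemma L2_circle_pointX n : L2 (fun t => cp t ^+ n).
Proof. by have := L2_poly 'X^n; under eq_fun do rewrite hornerXn. Qed.

Lemma L2_mul_poly f p : L2 f -> L2 (fun t => p.[cp t] * f t).
Proof. exact: L2M_bounded (cmeasurable_poly_circle p) (cabs_poly_circle p). Qed.

Lemma L2_mulX f n : L2 f -> L2 (fun t => cp t ^+ n * f t).
Proof.
by move=> Lf; have := L2_mul_poly 'X^n Lf; under eq_fun do rewrite hornerXn.
Qed.

Lemma cintegrable_mulX f n : cintegrable f -> cintegrable (fun t => f t * cp t ^+ n).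
Proof.
move=> fi; apply: le_cintegrable (cintegrable_cabs fi) => [|t].
  apply: cmeasurableM; first exact: cintegrable_measurable.
  by apply: cmeasurableX; exact: cmeasurable_circle_point.
by rewrite cabsM cabsX cabs_circle_point expr1n mulr1.
Qed.

Lemma cintegral_mul_poly f p : cintegrable f ->
  cintegral (fun t => f t * p.[cp t]) =
  \sum_(i < size p) p`_i * cintegral (fun t => f t * cp t ^+ i).
Proof.
move=> Lf; have fi n := cintegrable_mulX n Lf.
under eq_fun do rewrite horner_coef mulr_sumr.
under eq_fun do under eq_bigr do rewrite mulrCA.
rewrite cintegral_sum => [|i]; last exact: cintegrableZ.
by apply: eq_bigr => i _; rewrite cintegralZ.
Qed.

Lemma cintegral_poly_conjX p n :
  cintegral (fun t => p.[cp t] * conjc (cp t ^+ n)) = p`_n.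
Proof.
under eq_fun do rewrite mulrC.
rewrite cintegral_mul_poly; last exact/cintegrable_L2/L2_conj/L2_circle_pointX.
under eq_bigr do under eq_fun do rewrite mulrC.
under eq_bigr do rewrite cintegral_circle_point_conj.
have [np|np] := ltnP n (size p).
  rewrite (bigD1 (Ordinal np))//= eqxx mulr1 big1 ?addr0// => i /eqP ip.
  by case: eqP => [ni|_]; rewrite ?mulr0//; case: ip; apply: val_inj.
rewrite nth_default// big1// => i _; case: eqP => [ni|_]; rewrite ?mulr0//.
by have := ltn_ord i; rewrite -ni ltnNge np.
Qed.

Lemma cintegral_poly p : cintegral (fun t => p.[cp t]) = p.[0].
Proof.
rewrite horner_coef0 -(cintegral_poly_conjX p 0); congr cintegral.
by apply/funext => t; rewrite expr0 rmorph1 mulr1.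
Qed.

(** Parseval's identity for polynomials: one factor is expanded in powers, and the other,
    conjugated, integrates against each power to a conjugated coefficient. *)
Lemma sqnorm_poly p : sqnorm (fun t => p.[cp t]) = \sum_(i < size p) cabs p`_i ^+ 2.
Proof.
apply: (@complexI R); rewrite sqnormE.
have -> : (fun t => p.[cp t] * conjc p.[cp t]) = fun t => conjc (conjc p.[cp t] * p.[cp t]).
  by apply/funext => t; rewrite rmorphM/= conjcK.
have Lp := L2_poly p.
rewrite cintegral_conj; last exact: cintegrableM (L2_conj Lp) Lp.
rewrite cintegral_mul_poly; last exact/cintegrable_L2/L2_conj.
rewrite rmorph_sum [RHS]rmorph_sum; apply: eq_bigr => i _.
set J := cintegral _; have JE : conjc J = p`_i.
  rewrite -cintegral_conj; last exact: cintegrableM (L2_conj Lp) (L2_circle_pointX i).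
  rewrite -[RHS](cintegral_poly_conjX p i); congr cintegral; apply/funext => t.
  by rewrite rmorphM/= conjcK.
rewrite /= sqr_cabsE; transitivity (conjc p`_i * conjc J); first exact: rmorphM.
by rewrite JE mulrC.
Qed.

Lemma sqnorm_poly_wide n p : (size p <= n)%N ->
  sqnorm (fun t => p.[cp t]) = \sum_(i < n) cabs p`_i ^+ 2.
Proof.
move=> pn; rewrite sqnorm_poly (big_ord_widen n (fun i => cabs p`_i ^+ 2) pn).
rewrite big_mkcond; apply: eq_bigr => i _; case: ltnP => // h.
by rewrite nth_default// cabs0 expr0n.
Qed.

End CirclePolynomials.
(** * Power series on the disc *)

Section TaylorExpansion.
Variable R : realType.
Local Notation m := (circle_measure R).
Local Notation T := (measurableTypeR R).
Local Notation cp := (@circle_point R).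
Implicit Types (f g h : R -> R[i]) (U : R[i] -> R[i]) (a : nat -> R[i]).
Implicit Types (p q : {poly R[i]}).

Definition taylor a n : {poly R[i]} := \poly_(i < n) a i.

Definition expands U a : Prop := forall z : R[i], cabs z < 1 ->
  series (fun n => a n * z ^+ n : R[i]^o) @ \oo --> (U z : R[i]^o).

Lemma series_taylor a z n :
  series (fun n => a n * z ^+ n : R[i]^o) n = (taylor a n).[z].
Proof. by rewrite /series /= horner_poly big_mkord. Qed.

Lemma expandsP U a : expands U a <-> forall z, cabs z < 1 ->
  forall e : R, 0 < e -> \forall n \near \oo, cabs ((taylor a n).[z] - U z) < e.
Proof.
split=> h z z1.
  move=> e e0; have /cvgcP/(_ e e0) := h z z1.
  by apply: filterS => n; rewrite -series_taylor.
apply: (cvgcP (series (fun n => a n * z ^+ n : R[i]^o)) (U z)).2 => e e0.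
apply: filterS (h z z1 e e0) => n.
by rewrite -series_taylor.
Qed.

Lemma coef_taylor a n i : (taylor a n)`_i = if (i < n)%N then a i else 0.
Proof. exact: coef_poly. Qed.

Lemma size_taylor a n : (size (taylor a n) <= n)%N.
Proof. exact: size_poly. Qed.

Lemma geometric_tail_le (q : R) n k : 0 <= q < 1 -> (n <= k)%N ->
  \sum_(n <= i < k) q ^+ i <= q ^+ n / (1 - q).
Proof.
move=> /andP[q0 q1] nk; have q1' : 0 < 1 - q by rewrite subr_gt0.
rewrite ler_pdivlMr//.
suff -> : (\sum_(n <= i < k) q ^+ i) * (1 - q) = q ^+ n - q ^+ k.
  by rewrite gerBl exprn_ge0.
rewrite mulr_suml.
under eq_bigr do rewrite mulrBr mulr1 -exprSr -opprB.
by rewrite sumrN telescope_sumr// opprB.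
Qed.

Lemma near_geometric (q C e : R) : 0 <= q < 1 -> 0 < e ->
  exists N, forall n, (N <= n)%N -> C * q ^+ n <= e.
Proof.
move=> /andP[q0 q1] e0.
have : C * q ^+ n @[n --> \oo] --> C * 0.
  by apply: cvgM; [exact: cvg_cst|apply: cvg_expr; rewrite ger0_norm].
rewrite mulr0 => /cvgrPdist_le/(_ _ e0) [N _ hN].
by exists N => n /hN; rewrite sub0r normrN => /(le_trans (ler_norm _)).
Qed.

Lemma expands_coef_bound U a (r : R) : expands U a -> 0 <= r < 1 ->
  exists2 C, 0 <= C & forall n, cabs (a n) * r ^+ n <= C.
Proof.
move=> /expandsP hU /andP[r0 r1].
have r1' : cabs r%:C < 1 by rewrite cabs_real ger0_norm.
have [N _ hN] := hU _ r1' _ ltr01.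
have E n : cabs (a n) * r ^+ n = cabs ((taylor a n.+1).[r%:C] - (taylor a n).[r%:C]).
  rewrite !horner_poly big_ord_recr /= addrAC subrr add0r cabsM cabsX cabs_real.
  by rewrite ger0_norm.
(* From index [N] on, a term is the difference of two partial sums that are both within 1 of the
   limit, hence the 2; the finite sum covers the earlier terms. *)
exists (2 + \sum_(i < N) cabs (a i) * r ^+ i).
  by rewrite addr_ge0// sumr_ge0// => i _; rewrite mulr_ge0 ?cabs_ge0 ?exprn_ge0.
move=> n; have [nN|Nn] := ltnP n N.
  rewrite (bigD1 (Ordinal nN))//= addrCA lerDl addr_ge0// sumr_ge0// => i _.
  by rewrite mulr_ge0 ?cabs_ge0 ?exprn_ge0.
rewrite E; apply: (@le_trans _ _ 2); last first.
  by rewrite lerDl sumr_ge0// => i _; rewrite mulr_ge0 ?cabs_ge0 ?exprn_ge0.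
have h1 := hN _ Nn; have h2 := hN n.+1 (leqW Nn).
rewrite (le_trans (cabs_dist _ (U r%:C) _))// (cabsB (U _)).
by rewrite (_ : 2 = 1 + 1) ?lerD ?ltW//; ring.
Qed.

(** Abel's argument: with [s] halfway between [r] and 1, the terms at [s] are bounded, so on the
    disc of radius [r] the series is dominated by a geometric one of ratio [q = r / s]. *)
Lemma taylor_uniform U a (r e : R) : expands U a -> 0 <= r < 1 -> 0 < e ->
  exists N, forall n, (N <= n)%N ->
    forall z, cabs z <= r -> cabs ((taylor a n).[z] - U z) <= e.
Proof.
move=> Ua /andP[r0 r1] e0.
set s := (r + 1) / 2; have s01 : 0 < s < 1 by rewrite /s; apply/andP; split; lra.
have [C C0 hC] : exists2 C, 0 <= C & forall n, cabs (a n) * s ^+ n <= C.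
  by apply: expands_coef_bound Ua _; case/andP: s01 => /ltW -> ->.
have [s0 s1] := andP s01.
set q := r / s; have q01 : 0 <= q < 1.
  rewrite divr_ge0 ?(ltW s0)// ltr_pdivrMr// mul1r /s; lra.
have e20 : 0 < e / 2 by rewrite divr_gt0.
have [N hN] := near_geometric (C / (1 - q)) q01 e20.
exists N => n Nn z zr.
have z1 : cabs z < 1 by exact: le_lt_trans r1.
(* Pointwise convergence supplies a later partial sum close to [U z]. Its index depends on [z], but
   the bound on the block from [n] to [k] does not. *)
have [K _ hK] := (expandsP _ _).1 Ua z z1 _ e20.
set k := maxn n K; have nk : (n <= k)%N by exact: leq_maxl.
rewrite (le_trans (cabs_dist _ (taylor a k).[z] _))//.
rewrite [leRHS](_ : e = e / 2 + e / 2); last by field.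
rewrite lerD//; last by rewrite ltW// hK//= /k leq_maxr.
rewrite cabsB !horner_poly -!(big_mkord xpredT (fun i => a i * z ^+ i)).
rewrite (big_cat_nat (leq0n n) nk)//= addrAC subrr add0r.
rewrite (le_trans (cabs_sum _ _ _))//.
apply: (@le_trans _ _ (\sum_(n <= i < k) C * q ^+ i)).
  apply: ler_sum => i _; rewrite cabsM cabsX.
  apply: (@le_trans _ _ (cabs (a i) * r ^+ i)).
    by rewrite ler_wpM2l ?cabs_ge0// lerXn2r ?nnegrE ?cabs_ge0.
  have -> : r = s * q by rewrite /q mulrCA mulfV ?mulr1// gt_eqF.
  rewrite exprMn mulrA ler_wpM2r//.
  by rewrite exprn_ge0//; case/andP : q01.
rewrite -mulr_sumr (le_trans _ (hN n Nn))// -mulrA ler_wpM2l// mulrC.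
exact: geometric_tail_le.
Qed.

Lemma bernoulli_le (x : R) n : 0 <= x <= 1 -> 1 - n%:R * x <= (1 - x) ^+ n.
Proof.
move=> /andP[x0 x1]; elim: n => [|n ih]; first by rewrite mul0r subr0 expr0.
rewrite exprS -natr1; have n0 : 0 <= n%:R :> R by [].
have x1' : 0 <= 1 - x by lra.
have := ler_wpM2l x1' ih; apply: le_trans; nra.
Qed.

Definition dilate (r : R) p : {poly R[i]} := \poly_(i < size p) (p`_i * (r ^+ i)%:C).

Lemma horner_dilate r p z : (dilate r p).[z] = p.[r%:C * z].
Proof.
rewrite horner_poly horner_coef; apply: eq_bigr => i _.
by rewrite exprMn rmorphXn mulrA.
Qed.

Lemma coef_dilate r p i : (dilate r p)`_i = p`_i * (r ^+ i)%:C.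
Proof.
by rewrite coef_poly; case: ltnP => // h; rewrite nth_default// mul0r.
Qed.

Lemma size_dilate r p : (size (dilate r p) <= size p)%N.
Proof. exact: size_poly. Qed.

Lemma coef_norm1_ge0 p : 0 <= coef_norm1 p.
Proof. by apply: sumr_ge0 => i _; exact: cabs_ge0. Qed.

(** Coefficient by coefficient: [1 - r ^+ i <= i%:R * (1 - r)] by Bernoulli's inequality, and [i] is
    less than the size of [p]. *)
Lemma dilate_close r p z : 0 <= r <= 1 -> cabs z <= 1 ->
  cabs (p.[z] - (dilate r p).[z]) <= (1 - r) * ((size p)%:R * coef_norm1 p).
Proof.
move=> r01 z1; have [r0 r1] := andP r01.
rewrite horner_dilate !horner_coef -sumrB (le_trans (cabs_sum _ _ _))//.
rewrite mulrA mulr_sumr; apply: ler_sum => i _.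
have -> : p`_i * z ^+ i - p`_i * (r%:C * z) ^+ i = p`_i * ((1 - r ^+ i)%:C * z ^+ i).
  by rewrite exprMn rmorphB rmorphXn rmorph1; ring.
rewrite !cabsM cabsX cabs_real.
have ri1 : r ^+ i <= 1 by rewrite exprn_ile1.
rewrite ger0_norm ?subr_ge0// mulrC ler_wpM2r ?cabs_ge0//.
have b : 1 - i%:R * (1 - r) <= r ^+ i.
  by have := @bernoulli_le (1 - r) i; rewrite subKr; apply; apply/andP; split; lra.
apply: (@le_trans _ _ (1 - r ^+ i)).
  by rewrite ler_piMr ?subr_ge0// exprn_ile1 ?cabs_ge0.
apply: (@le_trans _ _ (i%:R * (1 - r))); first lra.
by rewrite mulrC ler_wpM2l ?subr_ge0// ler_nat ltnW.
Qed.

End TaylorExpansion.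
(** * The Hardy space *)

Section HardySpace.
Variable R : realType.
Local Notation m := (circle_measure R).
Local Notation T := (measurableTypeR R).
Local Notation cp := (@circle_point R).
Implicit Types (f g h : R -> R[i]) (U : R[i] -> R[i]) (a : nat -> R[i]).
Implicit Types (p q : {poly R[i]}).

Lemma cabs_circle_dilate (r : R) t : 0 <= r -> cabs (r%:C * cp t) = r.
Proof. by move=> r0; rewrite cabsM cabs_circle_point mulr1 cabs_real ger0_norm. Qed.

(** On the circle of radius [r] the function is a limit of polynomials, hence measurable, and within
    1 of one of them, hence bounded. *)
Lemma L2_disc U a (r : R) : expands U a -> 0 <= r < 1 -> L2 (fun t => U (r%:C * cp t)).
Proof.
move=> Ua r01; have [r0 r1] := andP r01.
have [N hN] := taylor_uniform Ua r01 ltr01.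
apply: (@L2_bounded _ (coef_norm1 (taylor a N) + 1)) => [|t].
  apply: (@cmeasurable_cvg _ (fun n t => (taylor a n).[r%:C * cp t])) => [n|t e e0].
    apply: cmeasurable_poly; apply: cmeasurableM; first exact: cmeasurable_cst.
    exact: cmeasurable_circle_point.
  by apply: ((expandsP U a).1 Ua _ _ _ e0); rewrite cabs_circle_dilate.
rewrite -[U _](subrK (taylor a N).[r%:C * cp t]) addrC.
rewrite (le_trans (cabsD _ _))//.
apply: lerD; last by rewrite cabsB hN ?cabs_circle_dilate.
by rewrite cabs_horner// cabs_circle_dilate// ltW.
Qed.

Lemma sqnorm_EFin f : L2 f -> (sqnorm f)%:E = (\int[m]_t (cabs (f t) ^+ 2)%:E)%E.
Proof. by move=> Lf; rewrite fineK//; exact: integrable_fin_num Lf.2. Qed.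

Lemma near1_expr n : exists2 r : R, 0 < r < 1 & 1 / 2 <= r ^+ n.
Proof.
have [x [x0 x1 nx]] : exists x : R, [/\ 0 < x, x < 1 & n%:R * x <= 1 / 2].
  have n0 : 0 < (2 * n.+1)%:R :> R by rewrite ltr0n.
  exists (2 * n.+1)%:R^-1; rewrite invr_gt0 n0 invf_lt1// ltr1n; split=> //; first by rewrite mulnS.
  by rewrite ler_pdivrMr// natrM -[n.+1%:R]natr1 mulrA divfK// mul1r lerDl.
exists (1 - x); first by rewrite subr_gt0 x1 gtrBl.
have x01 : 0 <= x <= 1 by rewrite !ltW.
by have := bernoulli_le n x01; apply: le_trans; lra.
Qed.

Lemma sqnorm_le_close f g : L2 f -> cmeasurable g ->
  (forall t, cabs (g t - f t) <= 1) -> sqnorm g <= 2 * (sqnorm f + 1).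
Proof.
move=> Lf mg gf.
have Lgf : L2 (fun t => g t - f t).
  by apply: L2_bounded gf; apply: cmeasurableB => //; exact: Lf.1.
have -> : sqnorm g = sqnorm (fun t => f t + (g t - f t)).
  by congr sqnorm; apply/funext => t; rewrite addrC subrK.
rewrite (le_trans (sqnormD Lf Lgf))// ler_wpM2l// lerD2l.
by rewrite -(expr1n _ 2) le_sqnorm_cst//; exact: Lgf.1.
Qed.

(** Parseval's identity for a dilated Taylor polynomial that is within 1 of [U] on the circle of
    radius [r], which produces [2 * (M + 1)]. The radius is taken with [r ^+ n >= 1 / 2], so each of
    the first [n] squared coefficients loses at most a factor 4. *)
Lemma hardy2_coef U a : hardy2_disc U -> expands U a ->
  exists C : R, forall n, \sum_(i < n) cabs (a i) ^+ 2 <= C.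
Proof.
move=> [_ [M hM]] Ua; exists (4 * (2 * (M + 1))) => n.
have [r /andP[r0 r1] rn] := near1_expr n.
have r01 : 0 <= r < 1 by rewrite ltW.
have LU := L2_disc Ua r01.
have [N hN] := taylor_uniform Ua r01 ltr01.
pose k := maxn n N; pose p := dilate r (taylor a k).
have h1 : sqnorm (fun t => p.[cp t]) <= 2 * (M + 1).
  have := hM r r01; rewrite -sqnorm_EFin// lee_fin => h.
  have : sqnorm (fun t => p.[cp t]) <= 2 * (sqnorm (fun t => U (r%:C * cp t)) + 1).
    apply: sqnorm_le_close => // [|t]; first exact: cmeasurable_poly_circle.
    by rewrite horner_dilate hN ?leq_maxr// cabs_circle_dilate// ltW.
  by move=> /le_trans; apply; lra.
rewrite (@sqnorm_poly_wide _ k) in h1; last first.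
  by rewrite (leq_trans (size_dilate _ _))// size_taylor.
rewrite mulrC -ler_pdivrMr//; apply: le_trans h1.
rewrite (big_ord_widen k (fun i => cabs (a i) ^+ 2)) ?leq_maxl//.
rewrite big_mkcond mulr_suml; apply: ler_sum => i _; case: ifP => [ni|_]; last first.
  by rewrite mul0r sqr_ge0.
rewrite coef_dilate coef_taylor ltn_ord cabsM exprMn ler_wpM2l ?sqr_ge0//.
rewrite cabs_real ger0_norm; last by rewrite exprn_ge0// ltW.
have ri : r ^+ n <= r ^+ i by apply: ler_wiXn2l; [exact: ltW|exact: ltW|exact: ltnW].
apply: (@le_trans _ _ ((1 / 2) ^+ 2)); first lra.
rewrite lerXn2r ?nnegrE//; last exact: le_trans ri.
by rewrite exprn_ge0// ltW.
Qed.

Lemma sum_tail_small (b : nat -> R) (C e : R) : (forall i, 0 <= b i) ->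
  (forall n, \sum_(i < n) b i <= C) -> 0 < e ->
  exists N, forall n, (N <= n)%N -> \sum_(N <= i < n) b i <= e.
Proof.
move=> b0 bC e0; pose E := [set \sum_(i < n) b i | n in [set: nat]].
have supE : has_sup E.
  split; first by exists (\sum_(i < 0) b i); exists 0%N.
  by exists C => _ [n _ <-]; exact: bC.
have [_ [N _ <-] hN] := sup_adherent e0 supE.
exists N => n Nn.
have : \sum_(i < n) b i <= sup E by apply: sup_upper_bound => //; exists n.
rewrite -!(big_mkord xpredT b) in hN *.
by rewrite (big_cat_nat (leq0n N) Nn)/=; lra.
Qed.

Lemma taylorB_sqnorm (r : R) a N M : 0 <= r <= 1 -> (N <= M)%N ->
  sqnorm (fun t => (dilate r (taylor a M - taylor a N)).[cp t]) <=
  \sum_(N <= i < M) cabs (a i) ^+ 2.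
Proof.
move=> /andP[r0 r1] NM; rewrite (@sqnorm_poly_wide _ M); last first.
  rewrite (leq_trans (size_dilate _ _))// (leq_trans (size_polyD _ _))//.
  by rewrite geq_max size_polyN size_taylor (leq_trans (size_taylor _ _)).
rewrite -(big_mkord xpredT
  (fun i => cabs (dilate r (taylor a M - taylor a N))`_i ^+ 2)).
rewrite (big_cat_nat (leq0n N) NM)/= big_nat big1 => [|i /andP[_ iN]]; last first.
  by rewrite coef_dilate coefB !coef_taylor iN (leq_trans iN NM) subrr mul0r cabs0 expr0n.
rewrite add0r big_nat [leRHS]big_nat; apply: ler_sum => i /andP[Ni iM].
rewrite coef_dilate coefB !coef_taylor iM ltnNge Ni subr0 cabsM exprMn.
rewrite ler_piMr ?sqr_ge0// cabs_real ger0_norm ?exprn_ge0// -exprM.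
by rewrite exprn_ile1.
Qed.

(** Replaces a radial limit by a limit along a sequence of radii, the form that [sqnorm_fatou]
    accepts. *)
Lemma near_at_left1 (P : R -> Prop) : (\forall r \near (1 : R)^'-, P r) ->
  \forall n \near \oo, P (1 - n.+2%:R^-1).
Proof.
move=> [d /= d0 hd]; apply: filterS (near_infty_natSinv_lt (PosNum d0)) => n /= nd.
have n2 : n.+2%:R^-1 <= n.+1%:R^-1 :> R by rewrite lef_pV2 ?posrE// ler_nat.
have n0 : 0 < n.+2%:R^-1 :> R by rewrite invr_gt0.
by apply: hd; rewrite /= ?gtrBl// opprB addrC subrK ger0_norm ?(ltW n0)// (le_lt_trans n2).
Qed.

(** By Parseval's identity, the dilated blocks [taylor a M - taylor a n] have squared norm at most a
    tail of the sum of the squared coefficients. As the radius tends to 1, with [M] growing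
    accordingly, they converge almost everywhere to [f] minus its Taylor polynomial, and Fatou's
    lemma transfers the bound. *)
Lemma H2_approx U f a (e : R) : hardy2_disc U -> boundary_values U f ->
  cmeasurable f -> expands U a -> 0 < e ->
  exists N, forall n, (N <= n)%N ->
    L2 (fun t => f t - (taylor a n).[cp t]) /\
    sqnorm (fun t => f t - (taylor a n).[cp t]) <= e.
Proof.
move=> HU bU mf Ua e0; have [C hC] := hardy2_coef HU Ua.
have [N hN] := sum_tail_small (fun i => sqr_ge0 (cabs (a i))) hC e0.
exists N => n Nn.
pose r k : R := 1 - k.+2%:R^-1.
have r01 k : 0 <= r k < 1.
  have n0 : 0 < k.+2%:R^-1 :> R by rewrite invr_gt0.
  have n1 : k.+2%:R^-1 <= 1 :> R by rewrite invf_le1 ?ler1n.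
  by rewrite /r subr_ge0 n1 gtrBl.
(* The degree is tied to the radius: at stage [k] it is large enough for the Taylor polynomial to
   follow [U] on the disc of radius [r k]. *)
have unif k : {M | (n <= M)%N &
    forall z, cabs z <= r k -> cabs ((taylor a M).[z] - U z) <= k.+1%:R^-1}.
  have k0 : 0 < k.+1%:R^-1 :> R by rewrite invr_gt0.
  apply: cid2; have [M hM] := taylor_uniform Ua (r01 k) k0.
  by exists (maxn n M); [exact: leq_maxl|apply: hM; exact: leq_maxr].
pose M k := s2val (unif k).
have nM k : (n <= M k)%N by exact: (s2valP (unif k)).
have hM k : forall z, cabs z <= r k -> cabs ((taylor a (M k)).[z] - U z) <= k.+1%:R^-1.
  exact: (s2valP' (unif k)).
pose S := taylor a n; pose B := (size S)%:R * coef_norm1 S.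
pose d k := dilate (r k) (taylor a (M k) - S).
apply: (@sqnorm_fatou _ (fun k t => (d k).[cp t])) => [|k|k|].
- by apply: cmeasurableB => //; exact: cmeasurable_poly_circle.
- exact: L2_poly.
- apply: le_trans (hN (M k) (leq_trans Nn (nM k))).
  apply: (@le_trans _ _ (\sum_(n <= i < M k) cabs (a i) ^+ 2)).
    by apply: taylorB_sqnorm => //; case/andP: (r01 k) => -> /ltW.
  by rewrite (big_cat_nat Nn (nM k))/= lerDr sumr_ge0// => i _; exact: sqr_ge0.
- apply: aeS bU => t /cvgcP bt e' e'0.
  have e30 : 0 < e' / 3 by rewrite divr_gt0.
  have hb := near_at_left1 (bt _ e30).
  have hs : \forall k \near \oo, k.+1%:R^-1 < e' / 3.
    exact: (near_infty_natSinv_lt (PosNum e30)).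
  have hB : \forall k \near \oo, k.+1%:R^-1 < (e' / 3) / (B + 1).
    have B0 : 0 < (e' / 3) / (B + 1).
      by rewrite divr_gt0// ltr_wpDl// mulr_ge0 ?coef_norm1_ge0.
    exact: (near_infty_natSinv_lt (PosNum B0)).
  near=> k.
  have z1 : cabs (cp t) <= 1 by rewrite cabs_circle_point.
  have [r0 r1] := andP (r01 k).
  have h1 : cabs (U ((r k)%:C * cp t) - f t) < e' / 3 by near: k.
  have h2 : cabs ((taylor a (M k)).[(r k)%:C * cp t] - U ((r k)%:C * cp t)) < e' / 3.
    apply: le_lt_trans (hM k _ _) _; first by rewrite cabs_circle_dilate.
    by near: k.
  have h3 : cabs (S.[cp t] - (dilate (r k) S).[cp t]) < e' / 3.
    have r01' : 0 <= r k <= 1 by rewrite r0 ltW.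
    apply: le_lt_trans (dilate_close S r01' z1) _.
    have B0 : 0 <= B by rewrite mulr_ge0 ?coef_norm1_ge0.
    rewrite -/B; apply: (@le_lt_trans _ _ (k.+1%:R^-1 * (B + 1))).
      rewrite ler_pM ?lerDl// /r; first by rewrite subKr invr_ge0.
      by rewrite subKr lef_pV2 ?posrE// ler_nat.
    by rewrite -ltr_pdivlMr ?ltr_wpDl//; near: k.
  rewrite /d horner_dilate hornerD hornerN -horner_dilate -horner_dilate horner_dilate.
  have -> : (taylor a (M k)).[(r k)%:C * cp t] - (dilate (r k) S).[cp t] - (f t - S.[cp t]) =
    ((taylor a (M k)).[(r k)%:C * cp t] - U ((r k)%:C * cp t)) +
    (U ((r k)%:C * cp t) - f t) + (S.[cp t] - (dilate (r k) S).[cp t]) by ring.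
  have := cabsD ((taylor a (M k)).[(r k)%:C * cp t] - U ((r k)%:C * cp t) +
    (U ((r k)%:C * cp t) - f t)) (S.[cp t] - (dilate (r k) S).[cp t]).
  have := cabsD ((taylor a (M k)).[(r k)%:C * cp t] - U ((r k)%:C * cp t))
    (U ((r k)%:C * cp t) - f t).
  lra.
Unshelve. all: by end_near. Qed.

Lemma H2_L2 U f a : hardy2_disc U -> boundary_values U f ->
  cmeasurable f -> expands U a -> L2 f.
Proof.
move=> HU bU mf Ua; have [N hN] := H2_approx HU bU mf Ua ltr01.
have [h _] := hN N (leqnn N); have := L2D h (L2_poly (taylor a N)).
by under eq_fun do rewrite subrK.
Qed.

(** In [outer_cyclic] the factor [Q] is matched with the dilate of [U], so [u] has to be
    approximated by Taylor polynomials dilated by the same radius. The radius is fixed before the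
    degree, which remains free to grow. *)
Lemma H2_approx_dilate U f a (e : R) : hardy2_disc U -> boundary_values U f ->
  cmeasurable f -> expands U a -> 0 < e ->
  exists2 r, 0 < r < 1 & exists N, forall n, (N <= n)%N ->
    sqnorm (fun t => f t - (dilate r (taylor a n)).[cp t]) <= e.
Proof.
move=> HU bU mf Ua e0; have [C hC] := hardy2_coef HU Ua.
(* Two uses of [sqnormD] weigh the three pieces by 2, 4 and 4, so [e / 16] for each amounts to 10 /
   16 of [e]. *)
have e80 : 0 < e / 16 by rewrite divr_gt0.
have [N1 hN1] := sum_tail_small (fun i => sqr_ge0 (cabs (a i))) hC e80.
have [N2 hN2] := H2_approx HU bU mf Ua e80.
pose N := maxn N1 N2; pose S := taylor a N.
pose B := (size S)%:R * coef_norm1 S.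
have B0 : 0 <= B by rewrite mulr_ge0 ?coef_norm1_ge0.
have [x x0 [x1 xB]] : exists2 x : R, 0 < x & x < 1 /\ (x * B) ^+ 2 <= e / 16.
  have e81 : 0 < 1 + e / 16 by rewrite addr_gt0.
  have B1 : 0 < B + 1 by rewrite ltr_wpDl.
  (* [q] is below both 1 and [e / 16], so that [y * B <= q] still gives [e / 16] after squaring. *)
  pose q := (e / 16) / (1 + e / 16).
  have q0 : 0 < q by rewrite divr_gt0.
  have q1 : q <= 1 by rewrite ler_pdivrMr// mul1r lerDr.
  have q2 : q <= e / 16 by rewrite ler_pdivrMr// ler_peMr ?lerDl// ltW.
  pose y := Num.min (1 / 2) (q / (B + 1)).
  have y0 : 0 < y by rewrite /y lt_min !divr_gt0.
  have yB : y * B <= q.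
    apply: (@le_trans _ _ (y * (B + 1))).
      by apply: ler_wpM2l; [exact: ltW|rewrite lerDl].
    by rewrite -ler_pdivlMr// /y ge_min lexx orbT.
  exists y => //; split; first by rewrite /y gt_min; apply/orP; left; lra.
  have yB0 : 0 <= y * B by apply: mulr_ge0 => //; exact: ltW.
  apply: le_trans q2; rewrite expr2 -[q]mulr1; apply: ler_pM => //.
  exact: le_trans q1.
have r1 : 0 < 1 - x < 1 by apply/andP; split; lra.
exists (1 - x) => //; exists N => n Nn; set r := 1 - x.
have r01 : 0 <= r <= 1 by case/andP: r1 => ? ?; rewrite !ltW.
have [LA hA] := hN2 N (leq_maxr _ _).
pose g1 t := S.[cp t] - (dilate r S).[cp t].
pose g2 t := (dilate r (S - taylor a n)).[cp t].
have Lg1 : L2 g1 by apply: L2B; exact: L2_poly.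
have Lg2 : L2 g2 by exact: L2_poly.
have h1 : sqnorm g1 <= e / 16.
  apply: le_trans xB; apply: le_sqnorm_cst => [|t]; first exact: Lg1.1.
  rewrite (le_trans (dilate_close S r01 _)) ?cabs_circle_point//.
  by rewrite /r subKr.
have h2 : sqnorm g2 <= e / 16.
  have -> : sqnorm g2 = sqnorm (fun t => (dilate r (taylor a n - S)).[cp t]).
    rewrite -sqnormN; congr sqnorm; apply/funext => t.
    by rewrite /g2 !horner_dilate -hornerN opprB.
  rewrite (le_trans (taylorB_sqnorm a r01 Nn))//.
  apply: le_trans (hN1 n (leq_trans (leq_maxl _ _) Nn)).
  rewrite (big_cat_nat (leq_maxl N1 N2) Nn)/= lerDr sumr_ge0// => i _.
  exact: sqr_ge0.
have -> : (fun t => f t - (dilate r (taylor a n)).[cp t]) =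
    fun t => (f t - S.[cp t]) + (g1 t + g2 t).
  apply/funext => t; rewrite /g1 /g2 !horner_dilate hornerD hornerN; ring.
rewrite (le_trans (sqnormD LA (L2D Lg1 Lg2)))//.
have := sqnormD Lg1 Lg2; lra.
Qed.

Lemma cintegral_H2_approx U f a psi (e : R) : hardy2_disc U -> boundary_values U f ->
  cmeasurable f -> expands U a -> L2 psi -> 0 < e ->
  exists N, forall n, (N <= n)%N ->
    cabs (cintegral (fun t => psi t * f t) -
          cintegral (fun t => psi t * (taylor a n).[cp t])) <= e.
Proof.
move=> HU bU mf Ua Lpsi e0.
have e20 : 0 < e ^+ 2 / (sqnorm psi + 1).
  by rewrite divr_gt0 ?exprn_gt0// ltr_wpDl ?sqnorm_ge0.
have [N hN] := H2_approx HU bU mf Ua e20; exists N => n /hN [Lf hf].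
have Lff := H2_L2 HU bU mf Ua.
rewrite -cintegralB; [|exact: cintegrableM|by apply: cintegrableM => //; exact: L2_poly].
under eq_fun do rewrite -mulrBr.
rewrite -(ler_pXn2r (n:=2))// ?nnegrE ?cabs_ge0 ?(ltW e0)//.
apply: le_trans (cauchy_schwarz Lpsi Lf) _.
apply: (@le_trans _ _ (sqnorm psi * (e ^+ 2 / (sqnorm psi + 1)))).
  by rewrite ler_wpM2l ?sqnorm_ge0.
rewrite mulrCA ler_piMr ?sqr_ge0// ler_pdivrMr ?mul1r ?lerDl// ltr_wpDl ?sqnorm_ge0//.
Qed.

End HardySpace.
(** * The complex exponential *)

Section ComplexExponential.
Variable R : realType.
Implicit Types (z w : R[i]) (x y : R).

Lemma cexpD z w : cexp (z + w) = cexp z * cexp w.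
Proof.
rewrite /cexp cReD cImD expRD cosD sinD; apply: complex_eq;
by rewrite ?cReM ?cImM /=; ring.
Qed.

Lemma cexp0 : cexp (0 : R[i]) = 1.
Proof. by rewrite /cexp /= expR0 cos0 sin0 mul1r. Qed.

Lemma cabs_cexp z : cabs (cexp z) = expR (complex.Re z).
Proof.
rewrite /cexp cabsM cabs_real ger0_norm ?expR_ge0//.
by rewrite [X in _ * X]/cabs /= cos2Dsin2 sqrtr1 mulr1.
Qed.

Lemma cexp_neq0 z : cexp z != 0.
Proof. by rewrite -cabs_eq0 cabs_cexp gt_eqF ?expR_gt0. Qed.

Lemma cexp_natmul n z : cexp ((n%:R)%:C * z) = cexp z ^+ n.
Proof.
elim: n => [|n ih]; first by rewrite mul0r cexp0 expr0.
by rewrite -natr1 rmorphD/= mulrDl mul1r cexpD ih exprSr.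
Qed.

Lemma cexp_real x : cexp x%:C = (expR x)%:C.
Proof. by rewrite /cexp /= cos0 sin0 mulr1. Qed.

Lemma le_norm_sin x : `|sin x| <= `|x|.
Proof.
wlog x0 : x / 0 <= x => [hw|].
  have [/hw//|/ltW x0] := leP 0 x.
  by rewrite -normrN -sinN -[leRHS]normrN hw// oppr_ge0.
have cs : {within `[0, x], continuous (@sin R)}.
  by apply: continuous_subspaceT => y; exact: continuous_sin.
have [c _] := MVT_segment x0 (fun y _ => is_derive_sin y) cs.
by rewrite sin0 !subr0 => ->; rewrite normrM ler_piMl// cos_max.
Qed.

Lemma le_norm_1Bcos x : `|cos x - 1| <= x ^+ 2 / 2.
Proof.
have e : cos x - 1 = - 2 * sin (x / 2) ^+ 2.
  rewrite {1}(_ : x = (x / 2) *+ 2); last by rewrite mulr2n -splitr.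
  by rewrite cos_mulr2n cos2sin2 -mulr_natl; ring.
rewrite e mulNr normrN normrM normrX ger0_norm//.
have : `|sin (x / 2)| ^+ 2 <= `|x / 2| ^+ 2.
  by rewrite lerXn2r ?nnegrE// le_norm_sin.
rewrite !real_normK ?num_real//; have -> : (x / 2) ^+ 2 = x ^+ 2 / 4 by field.
lra.
Qed.

Lemma le_norm_sinB x : `|x| <= 1 -> `|sin x - x| <= x ^+ 2.
Proof.
wlog x0 : x / 0 <= x => [hw|].
  have [/hw//|/ltW x0] := leP 0 x.
  have -> : sin x - x = - (sin (- x) - (- x)) by rewrite sinN; ring.
  by move=> x1; rewrite normrN -[leRHS]sqrrN; apply: hw; rewrite ?normrN ?oppr_ge0.
rewrite ger0_norm// => x1.
have cs : {within `[0, x], continuous (@sin R)}.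
  by apply: continuous_subspaceT => y; exact: continuous_sin.
have [c] := MVT_segment x0 (fun y _ => is_derive_sin y) cs.
rewrite in_itv/= => /andP[c0 cx]; rewrite sin0 !subr0 => ->.
rewrite -[X in _ - X]mul1r -mulrBl normrM (ger0_norm x0).
have := le_norm_1Bcos c; have : 0 <= `|cos c - 1| by [].
nra.
Qed.

(** Everything comes from [1 + x <= expR x], used at [x] and, in the form [expR x * (1 - x) <= 1],
    at [- x]. *)
Lemma expR_bounds x : `|x| <= 1 / 2 -> [/\ expR x <= 2,
  `|expR x - 1| <= 2 * `|x| & `|expR x - 1 - x| <= 2 * x ^+ 2].
Proof.
move=> hx; have := hx; rewrite ler_norml => /andP[x1 x2].
have h1 := expR_ge1Dx x; have h2 := expR_ge1Dx (- x).
have h3 : expR x * (1 - x) <= 1.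
  by rewrite -[leRHS](expRxMexpNx_1 x) ler_wpM2l ?expR_ge0.
have e0 := expR_ge0 x.
have h4 : expR x <= 2 by nra.
have h5 : expR x - 1 - x <= 2 * x ^+ 2 by nra.
split=> //; last by rewrite ger0_norm//; lra.
rewrite ler_norml; have [x0|x0] := leP 0 x.
  by rewrite ger0_norm//; apply/andP; split; nra.
by rewrite ltr0_norm//; apply/andP; split; nra.
Qed.

(** As [cexp] is built from real functions, real and imaginary parts are estimated separately. The
    four resulting terms are at most 2, 1, 2 and 2 times [s ^+ 2], within the constant 8. *)
Lemma cexp_taylor1 z : cabs z <= 1 / 2 -> cabs (cexp z - 1 - z) <= 8 * cabs z ^+ 2.
Proof.
move=> z1; set s := cabs z in z1 *.
have s0 : 0 <= s by exact: cabs_ge0.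
have xs : `|complex.Re z| <= s by exact: ler_Re_cabs.
have ys : `|complex.Im z| <= s by exact: ler_Im_cabs.
apply: le_trans (cabs_le_ReIm _) _.
have -> : complex.Re (cexp z - 1 - z) = expR (complex.Re z) * cos (complex.Im z) - 1 - complex.Re z.
  by rewrite /cexp !cReD !cReN cReM /=; ring.
have -> : complex.Im (cexp z - 1 - z) = expR (complex.Re z) * sin (complex.Im z) - complex.Im z.
  by rewrite /cexp !cImD !cImN cImM /=; ring.
move: (complex.Re z) (complex.Im z) xs ys => x y xs ys.
have [e2 e1 ex] := expR_bounds (le_trans xs z1).
have e0 := expR_ge0 x.
have cy := le_norm_1Bcos y.
have sy : `|sin y - y| <= y ^+ 2 by apply: le_norm_sinB; lra.
have x2 : x ^+ 2 <= s ^+ 2 by rewrite -(real_normK (num_real x)) lerXn2r ?nnegrE.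
have y2 : y ^+ 2 <= s ^+ 2 by rewrite -(real_normK (num_real y)) lerXn2r ?nnegrE.
have -> : expR x * cos y - 1 - x = (expR x - 1 - x) + expR x * (cos y - 1) by ring.
have -> : expR x * sin y - y = expR x * (sin y - y) + (expR x - 1) * y by ring.
have r1 := ler_normD (expR x - 1 - x) (expR x * (cos y - 1)).
have r2 := ler_normD (expR x * (sin y - y)) ((expR x - 1) * y).
have a1 : `|expR x * (cos y - 1)| <= 2 * (s ^+ 2 / 2).
  rewrite normrM ger0_norm// ler_pM//; apply: (le_trans cy); lra.
have a2 : `|expR x * (sin y - y)| <= 2 * s ^+ 2.
  by rewrite normrM ger0_norm// ler_pM//; apply: (le_trans sy).
have a3 : `|(expR x - 1) * y| <= 2 * s * s.
  rewrite normrM ler_pM//; apply: (le_trans e1); lra.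
rewrite -mulrA -expr2 in a3.
by have ex' := le_trans ex (ler_wpM2l (ler0n _ 2) x2); have := sqr_ge0 s; lra.
Qed.

Lemma cabs_exprB (z w : R[i]) (K : R) n : 1 <= K -> cabs z <= K -> cabs w <= K ->
  cabs (z ^+ n - w ^+ n) <= n%:R * cabs (z - w) * K ^+ n.
Proof.
move=> K1 zK wK; have K0 : 0 <= K by lra.
elim: n => [|n ih]; first by rewrite subrr cabs0 !mul0r.
have -> : z ^+ n.+1 - w ^+ n.+1 = z * (z ^+ n - w ^+ n) + (z - w) * w ^+ n.
  by rewrite !exprS; ring.
apply: le_trans (cabsD _ _) _.
rewrite !cabsM cabsX.
have h1 : cabs z * cabs (z ^+ n - w ^+ n) <= K * (n%:R * cabs (z - w) * K ^+ n).
  by rewrite ler_pM ?cabs_ge0.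
have h2 : cabs (z - w) * cabs w ^+ n <= cabs (z - w) * K ^+ n.+1.
  rewrite ler_wpM2l ?cabs_ge0//; apply: (@le_trans _ _ (K ^+ n)).
    by rewrite lerXn2r ?nnegrE ?cabs_ge0.
  by rewrite exprS ler_peMl ?exprn_ge0.
apply: le_trans (lerD h1 h2) _; rewrite exprS -natr1 le_eqVlt; apply/orP; left.
by apply/eqP; ring.
Qed.

(** Makes the exponential a limit of polynomials with an explicit error. The bases [1 + z / n] and
    [cexp (w / n)] have modulus at most [expR (B / n)] and differ by [cabs (z - w) / n] up to second
    order; the power [n] costs a factor [n] and [expR B]. The condition on [n] puts [w / n] in the
    range of [cexp_taylor1]. *)
Lemma cexp_euler z w (B : R) n : cabs z <= B -> cabs w <= B -> 2 * B < n%:R ->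
  cabs ((1 + (n%:R^-1)%:C * z) ^+ n - cexp w) <=
  expR B * (cabs (z - w) + 8 * B ^+ 2 / n%:R).
Proof.
move=> zB wB Bn; have B0 : 0 <= B := le_trans (cabs_ge0 _) zB.
have n0 : 0 < n%:R :> R by lra.
pose c : R[i] := (n%:R^-1)%:C.
have nc : (n%:R)%:C * c = 1 by rewrite -rmorphM/= mulfV// gt_eqF.
have cdiv v : cabs (c * v) = cabs v / n%:R.
  by rewrite cabsM cabs_real ger0_norm ?invr_ge0 ?(ltW n0)// mulrC.
have K1 : 1 <= expR (B / n%:R) by rewrite -expR0 ler_expR divr_ge0// ltW.
have Bdiv v : cabs v <= B -> cabs (c * v) <= B / n%:R.
  by move=> vB; rewrite cdiv ler_wpM2r// invr_ge0 ltW.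
have zK : cabs (1 + c * z) <= expR (B / n%:R).
  apply: le_trans (expR_ge1Dx _); apply: le_trans (cabsD _ _) _.
  by rewrite cabs1 lerD2l Bdiv.
have wK : cabs (cexp (c * w)) <= expR (B / n%:R).
  by rewrite cabs_cexp ler_expR (le_trans (ler_norm _))// (le_trans (ler_Re_cabs _))// Bdiv.
have -> : cexp w = cexp (c * w) ^+ n by rewrite -cexp_natmul mulrA nc mul1r.
apply: le_trans (cabs_exprB n K1 zK wK) _.
rewrite -expRM_natl mulrCA mulfV ?gt_eqF// mulr1 mulrC ler_wpM2l ?expR_ge0//.
have w2 : cabs (c * w) <= 1 / 2.
  by rewrite (le_trans (Bdiv _ wB))// ler_pdivrMr//; lra.
have h := cexp_taylor1 w2.
have hd : cabs (1 + c * z - cexp (c * w)) <=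
    cabs (z - w) / n%:R + 8 * (B / n%:R) ^+ 2.
  have -> : 1 + c * z - cexp (c * w) =
    c * (z - w) - (cexp (c * w) - 1 - c * w) by ring.
  apply: le_trans (cabsBD _ _) _; rewrite cdiv lerD2l; apply: le_trans h _.
  by rewrite ler_wpM2l// lerXn2r ?nnegrE ?cabs_ge0 ?Bdiv// divr_ge0// ltW.
apply: le_trans (ler_wpM2l (ltW n0) hd) _.
rewrite le_eqVlt; apply/orP; left; apply/eqP; field.
by rewrite gt_eqF.
Qed.

End ComplexExponential.
(** * The Herglotz integral *)

Section Herglotz.
Variable R : realType.
Local Notation m := (circle_measure R).
Local Notation T := (measurableTypeR R).
Local Notation cp := (@circle_point R).
Implicit Types (k : R -> R) (z w : R[i]).

Definition herglotz_kernel w (t : R) : R[i] := (cp t + w) / (cp t - w).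

Definition herglotz k w : R[i] := cintegral (fun t => herglotz_kernel w t * (k t)%:C).

Lemma cabs_mul_conj w t : cabs (w * conjc (cp t)) = cabs w.
Proof. by rewrite cabsM cabs_conj cabs_circle_point mulr1. Qed.

Lemma cabs_1B_ge w t : 1 - cabs w <= cabs (1 - w * conjc (cp t)).
Proof.
have := cabsD (1 - w * conjc (cp t)) (w * conjc (cp t)).
by rewrite subrK cabs1 cabs_mul_conj; lra.
Qed.

Lemma disc_1B_neq0 w t : cabs w < 1 -> 1 - w * conjc (cp t) != 0.
Proof.
by move=> w1; rewrite -cabs_eq0 gt_eqF// (lt_le_trans _ (cabs_1B_ge w t))// subr_gt0.
Qed.

Lemma herglotz_kernelE w t : herglotz_kernel w t =
  (1 + w * conjc (cp t)) / (1 - w * conjc (cp t)).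
Proof.
have cJ := circle_pointJ t; have c0 := circle_point_neq0 t.
have e1 : cp t + w = cp t * (1 + w * conjc (cp t)).
  by rewrite mulrDr mulr1 mulrCA cJ mulr1.
have e2 : cp t - w = cp t * (1 - w * conjc (cp t)).
  by rewrite mulrBr mulr1 mulrCA cJ mulr1.
by rewrite /herglotz_kernel e1 e2 invfM mulrACA mulfV// mul1r.
Qed.

Lemma geometric_conj w t n : cabs w < 1 ->
  \sum_(j < n) (w * conjc (cp t)) ^+ j =
  (1 - (w * conjc (cp t)) ^+ n) / (1 - w * conjc (cp t)).
Proof.
move=> w1; set v := w * _; have v1 : 1 - v != 0 by exact: disc_1B_neq0.
apply: (mulIf v1); rewrite divfK//.
by rewrite -[X in _ = X - _](expr1n _ n) subrXX mulrC; congr (_ * _); apply: eq_bigr => i _;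
  rewrite expr1n mul1r.
Qed.

(** With [v = w * conjc (cp t)] the kernel is [2 / (1 - v) - 1], and the geometric sum leaves the
    remainder [2 * v ^+ n / (1 - v)]. *)
Lemma herglotz_kernel_trunc w t n : cabs w < 1 ->
  cabs (herglotz_kernel w t - (2 * \sum_(j < n) (w * conjc (cp t)) ^+ j - 1)) <=
  2 * cabs w ^+ n / (1 - cabs w).
Proof.
move=> w1; rewrite herglotz_kernelE geometric_conj//.
have v1 := disc_1B_neq0 t w1; have w0 : 0 < 1 - cabs w by rewrite subr_gt0.
set v := w * conjc (cp t) in v1 *.
have -> : (1 + v) / (1 - v) - (2 * ((1 - v ^+ n) / (1 - v)) - 1) = (2%:R)%:C * v ^+ n / (1 - v).
  by rewrite rmorph_nat; field.
rewrite !cabsM cabsV cabs_real normr_nat cabsX cabs_mul_conj.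
rewrite ler_wpM2l ?mulr_ge0 ?exprn_ge0 ?cabs_ge0// lef_pV2 ?posrE ?cabs_1B_ge//.
exact: lt_le_trans (cabs_1B_ge w t).
Qed.

Lemma cabs_herglotz_kernel w t : cabs w < 1 ->
  cabs (herglotz_kernel w t) <= 2 / (1 - cabs w).
Proof.
move=> w1; rewrite herglotz_kernelE cabsM cabsV.
have w0 : 0 < 1 - cabs w by rewrite subr_gt0.
rewrite ler_pM ?cabs_ge0 ?invr_ge0 ?cabs_ge0//.
  apply: le_trans (cabsD _ _) _; rewrite cabs1 cabs_mul_conj; lra.
rewrite lef_pV2 ?posrE ?cabs_1B_ge//.
exact: lt_le_trans (cabs_1B_ge w t).
Qed.

(** The real part is the Poisson kernel [(1 - cabs v ^+ 2) / cabs (1 - v) ^+ 2]. *)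
Lemma Re_herglotz_kernel w t : cabs w < 1 -> 0 <= complex.Re (herglotz_kernel w t).
Proof.
move=> w1; rewrite herglotz_kernelE.
have v1 := disc_1B_neq0 t w1.
have vw := cabs_mul_conj w t.
set v := w * conjc (cp t) in v1 vw *.
have -> : (1 + v) / (1 - v) = (1 + v) * conjc (1 - v) * ((cabs (1 - v) ^+ 2)^-1)%:C.
  by rewrite fmorphV/= sqr_cabsE invfM mulrACA mulfV ?mulr1 ?conjc_eq0.
have -> : complex.Re ((1 + v) * conjc (1 - v) * ((cabs (1 - v) ^+ 2)^-1)%:C) =
   (1 - cabs v ^+ 2) * (cabs (1 - v) ^+ 2)^-1.
  rewrite (sqr_cabs v) !(cReM, cImM, cReJ, cReD, cReN, cImJ, cImD, cImN) /=; ring.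
rewrite mulr_ge0 ?invr_ge0 ?sqr_ge0// subr_ge0 vw expr_le1 ?cabs_ge0//.
exact: ltW.
Qed.

Lemma cmeasurable_kernel w : cmeasurable (herglotz_kernel w).
Proof.
apply: cmeasurableM.
  apply: cmeasurableD; [exact: cmeasurable_circle_point|exact: cmeasurable_cst].
apply: cmeasurableV.
by apply: cmeasurableB; [exact: cmeasurable_circle_point|exact: cmeasurable_cst].
Qed.

Lemma cintegrable_mul_bounded (C : R) (f : R -> R[i]) k : cmeasurable f ->
  (forall t, cabs (f t) <= C) -> rintegrable k -> cintegrable (fun t => f t * (k t)%:C).
Proof.
move=> mf fC ki; have ai : rintegrable (fun t => `|k t|) by exact: integrable_norm.
apply: le_cintegrable (rintegrableZ C ai) => [|t].
  by apply: cmeasurableM => //; apply: cmeasurable_real; exact: rintegrable_measurable.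
by rewrite cabsM cabs_real ler_wpM2r.
Qed.

Lemma cintegrable_herglotz k w : cabs w < 1 -> rintegrable k ->
  cintegrable (fun t => herglotz_kernel w t * (k t)%:C).
Proof.
move=> w1; apply: (@cintegrable_mul_bounded (2 / (1 - cabs w))) => [|t].
  exact: cmeasurable_kernel.
exact: cabs_herglotz_kernel.
Qed.

Lemma le_cintegral_mul_bounded (C : R) (f : R -> R[i]) k : cmeasurable f ->
  (forall t, cabs (f t) <= C) -> rintegrable k ->
  cabs (cintegral (fun t => f t * (k t)%:C)) <= C * \int[m]_t `|k t|.
Proof.
move=> mf fC ki; have ai : rintegrable (fun t => `|k t|) by exact: integrable_norm.
have fi := cintegrable_mul_bounded mf fC ki.
apply: le_trans (le_cabs_cintegral fi) _.
rewrite -RintegralZl//; apply: le_rintegral; [exact: cintegrable_cabs|exact: rintegrableZ|].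
by move=> t; rewrite cabsM cabs_real ler_wpM2r.
Qed.

Lemma cabs_herglotz k w : cabs w < 1 -> rintegrable k ->
  cabs (herglotz k w) <= 2 / (1 - cabs w) * \int[m]_t `|k t|.
Proof.
move=> w1; apply: le_cintegral_mul_bounded => [|t]; first exact: cmeasurable_kernel.
exact: cabs_herglotz_kernel.
Qed.

Lemma herglotzB k1 k2 w : cabs w < 1 -> rintegrable k1 -> rintegrable k2 ->
  herglotz (fun t => k1 t - k2 t) w = herglotz k1 w - herglotz k2 w.
Proof.
move=> w1 i1 i2; rewrite -cintegralB; [|exact: cintegrable_herglotz..].
by congr cintegral; apply/funext => t; rewrite -mulrBr rmorphB.
Qed.

Lemma Re_herglotz_ge0 k w : cabs w < 1 -> rintegrable k -> (forall t, 0 <= k t) ->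
  0 <= complex.Re (herglotz k w).
Proof.
move=> w1 ki k0; apply: Rintegral_ge0 => t _.
by rewrite cReM /= mulr0 subr0 mulr_ge0// Re_herglotz_kernel.
Qed.

Lemma herglotz0 k : herglotz k 0 = (\int[m]_t k t)%:C.
Proof.
rewrite -cintegral_real; congr cintegral; apply/funext => t.
by rewrite /herglotz_kernel addr0 subr0 divff ?mul1r// circle_point_neq0.
Qed.

(** Partial sum of the power series of [herglotz k], obtained from the expansion
    [2 * \sum_j v ^+ j - 1] of the kernel; the subtracted constant comes from the -1. *)
Definition herglotz_poly k n : {poly R[i]} :=
  \poly_(j < n) (2 * cintegral (fun t => conjc (cp t) ^+ j * (k t)%:C)) -
  ((\int[m]_t k t)%:C)%:P.

Lemma cmeasurable_conjX n : cmeasurable (fun t => conjc (cp t) ^+ n).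
Proof. by apply: cmeasurableX; apply: cmeasurable_conj; exact: cmeasurable_circle_point. Qed.

Lemma cabs_conjX n t : cabs (conjc (cp t) ^+ n) <= 1.
Proof. by rewrite cabsX cabs_conj cabs_circle_point expr1n. Qed.

Lemma horner_herglotz_poly k n w : rintegrable k -> (herglotz_poly k n).[w] =
  cintegral (fun t => (2 * \sum_(j < n) (w * conjc (cp t)) ^+ j - 1) * (k t)%:C).
Proof.
move=> ki; have ji j : cintegrable (fun t => conjc (cp t) ^+ j * (k t)%:C).
  exact: cintegrable_mul_bounded (cmeasurable_conjX j) (cabs_conjX j) ki.
have -> : (fun t => (2 * \sum_(j < n) (w * conjc (cp t)) ^+ j - 1) * (k t)%:C) =
  fun t => \sum_(j < n) (2 * w ^+ j) * (conjc (cp t) ^+ j * (k t)%:C) - (k t)%:C.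
  apply/funext => t; rewrite mulrBl mul1r mulr_sumr mulr_suml; congr (_ - _).
  by apply: eq_bigr => j _; rewrite exprMn; ring.
rewrite cintegralB; last 2 first.
- by apply: cintegrable_sum => j; exact: cintegrableZ.
- exact: cintegrable_real.
rewrite cintegral_real cintegral_sum => [|j]; last exact: cintegrableZ.
rewrite /herglotz_poly hornerD hornerN hornerC horner_poly; congr (_ - _).
by apply: eq_bigr => j _; rewrite cintegralZ// mulrAC.
Qed.

Lemma herglotz_trunc k n w : cabs w < 1 -> rintegrable k ->
  cabs (herglotz k w - (herglotz_poly k n).[w]) <=
  2 * cabs w ^+ n / (1 - cabs w) * \int[m]_t `|k t|.
Proof.
move=> w1 ki; rewrite horner_herglotz_poly//.
pose g t := 2 * \sum_(j < n) (w * conjc (cp t)) ^+ j - 1 : R[i].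
have mg : cmeasurable g.
  apply: cmeasurableB; last exact: cmeasurable_cst.
  apply: cmeasurableM; first exact: cmeasurable_cst.
  apply: cmeasurable_sum => j; apply: cmeasurableX.
  apply: cmeasurableM; first exact: cmeasurable_cst.
  by apply: cmeasurable_conj; exact: cmeasurable_circle_point.
have gb t : cabs (g t) <= 2 / (1 - cabs w) + 2 * cabs w ^+ n / (1 - cabs w).
  have -> : g t = herglotz_kernel w t - (herglotz_kernel w t - g t) by ring.
  apply: le_trans (cabsBD _ _) _.
  by rewrite lerD ?cabs_herglotz_kernel ?herglotz_kernel_trunc.
rewrite -cintegralB; [|exact: cintegrable_herglotz|exact: cintegrable_mul_bounded gb ki].
under eq_fun do rewrite -mulrBl.
apply: le_cintegral_mul_bounded => // [|t].
  by apply: cmeasurableB => //; exact: cmeasurable_kernel.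
exact: herglotz_kernel_trunc.
Qed.

(** Normalization of the Poisson kernel, read off the truncations: orthogonality of the powers
    leaves only the constant coefficient, which is 2 - 1. *)
Lemma herglotz1 w : cabs w < 1 -> herglotz (cst 1) w = 1.
Proof.
move=> w1; have i1 : rintegrable (cst 1 : R -> R) by exact: rintegrable_cst.
have w0 : 0 < 1 - cabs w by rewrite subr_gt0.
have p1 n : (herglotz_poly (cst 1) n.+1).[w] = 1.
  rewrite /herglotz_poly hornerD hornerN hornerC horner_poly rintegral_cst.
  rewrite big_ord_recl big1 => [|j _]; last first.
    rewrite (_ : cintegral _ = 0) ?mulr0 ?mul0r//.
    have -> : (fun t => conjc (cp t) ^+ lift ord0 j * (cst 1 t)%:C) =
      fun t => cp t ^+ 0 * conjc (cp t ^+ lift ord0 j).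
      by apply/funext => t; rewrite mulr1 mul1r rmorphXn.
    by rewrite cintegral_circle_point_conj.
  rewrite (_ : cintegral _ = 1) ?expr0; last first.
    have -> : (fun t => conjc (cp t) ^+ (@ord0 n) * (cst 1 t)%:C) = cst 1.
      by apply/funext => t; rewrite mulr1.
    exact: cintegral_cst.
  by rewrite rmorph1; ring.
apply/eqP; rewrite -subr_eq0 -cabs_eq0 eq_le cabs_ge0 andbT.
apply/ler_addgt0Pr => e e0; rewrite add0r.
have w01 : 0 <= cabs w < 1 by rewrite cabs_ge0.
have [N hN] := near_geometric (2 / (1 - cabs w)) w01 e0.
apply: le_trans (hN N.+1 (leqnSn N)).
have := herglotz_trunc N.+1 w1 i1; rewrite p1 => /le_trans; apply.
have -> : \int[m]_t `|(cst 1 t : R)| = 1.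
  by under eq_Rintegral do rewrite normr1; rewrite rintegral_cst.
by rewrite mulr1 mulrAC.
Qed.

Lemma Re_herglotz_ge k w c : cabs w < 1 -> rintegrable k -> (forall t, c <= k t) ->
  c <= complex.Re (herglotz k w).
Proof.
move=> w1 ki kc; have ci : rintegrable (fun=> c) by exact: rintegrable_cst.
have : 0 <= complex.Re (herglotz (fun t => k t - c) w).
  by apply: Re_herglotz_ge0 => // [|t]; [exact: rintegrableB|rewrite subr_ge0].
rewrite herglotzB// cReD cReN subr_ge0; apply: le_trans.
have -> : herglotz (fun=> c) w = c%:C * herglotz (cst 1) w.
  rewrite -cintegralZ; last by apply: cintegrable_herglotz => //; exact: rintegrable_cst.
  by congr cintegral; apply/funext => t; rewrite mulr1 mulrC.
by rewrite herglotz1// mulr1.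
Qed.

(** Two polynomial approximations are composed: a truncation of the Herglotz series, uniform on the
    disc of radius [r], is inserted into Euler's [(1 - p / n) ^ n]. *)
Lemma cexp_herglotz_approx k (r eta : R) : rintegrable k -> 0 <= r < 1 -> 0 < eta ->
  exists Q : {poly R[i]}, forall z, cabs z <= 1 ->
    cabs (Q.[z] - cexp (- herglotz k (r%:C * z))) <= eta.
Proof.
move=> ki r01 eta0; have [r0 r1] := andP r01.
pose I := \int[m]_t `|k t|.
have I0 : 0 <= I by apply: Rintegral_ge0.
have r10 : 0 < 1 - r by rewrite subr_gt0.
(* The first term bounds [herglotz k] on the disc of radius [r]; the 1 covers its truncation, which
   is within [d <= 1]. *)
pose B := 2 / (1 - r) * I + 1.
have B0 : 0 <= B by rewrite addr_ge0// mulr_ge0// divr_ge0// ltW.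
have E0 := expR_gt0 B.
have ee : 0 < eta / (2 * expR B) by rewrite divr_gt0// mulr_gt0.
pose d := Num.min 1 (eta / (2 * expR B)).
have d0 : 0 < d by rewrite /d lt_min ltr01.
have [K hK] := near_geometric (2 / (1 - r) * I) r01 d0.
have [n [nB nd]] : exists n : nat, 2 * B < n%:R /\ 8 * B ^+ 2 / n%:R <= eta / (2 * expR B).
  pose x := 2 * B + 8 * B ^+ 2 / (eta / (2 * expR B)).
  have x0 : 0 <= 8 * B ^+ 2 / (eta / (2 * expR B)).
    by apply: divr_ge0; [rewrite mulr_ge0 ?sqr_ge0|exact: ltW].
  exists (Num.trunc x).+1; have xn : x < (Num.trunc x).+1%:R := truncnS_gt x.
  split; first by apply: le_lt_trans xn; rewrite lerDl.
  rewrite ler_pdivrMr// [leRHS]mulrC -ler_pdivrMr//.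
  by apply: le_trans _ (ltW xn); rewrite lerDr mulr_ge0.
pose p := dilate r (herglotz_poly k K).
exists ((1 + (n%:R^-1)%:C *: (- p)) ^+ n) => z z1.
have rz : cabs (r%:C * z) <= r.
  by rewrite cabsM cabs_real ger0_norm// ler_piMr.
have rz1 : cabs (r%:C * z) < 1 by exact: le_lt_trans r1.
have I1r : (1 - cabs (r%:C * z))^-1 <= (1 - r)^-1.
  by rewrite lef_pV2 ?posrE ?subr_gt0// lerB.
have h1 : cabs (herglotz k (r%:C * z) - p.[z]) <= d.
  rewrite horner_dilate; apply: le_trans (herglotz_trunc K rz1 ki) _.
  apply: le_trans (hK K (leqnn K)).
  rewrite [leRHS](_ : _ = 2 * r ^+ K / (1 - r) * I); last by rewrite -/I; ring.
  apply: ler_wpM2r => //; apply: ler_pM => //.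
  - by rewrite mulr_ge0 ?exprn_ge0 ?cabs_ge0.
  - by rewrite invr_ge0 subr_ge0; exact: ltW.
  - by rewrite ler_wpM2l// lerXn2r ?nnegrE ?cabs_ge0.
have h2 : cabs (herglotz k (r%:C * z)) <= 2 / (1 - r) * I.
  by apply: le_trans (cabs_herglotz rz1 ki) _; rewrite ler_wpM2r// ler_wpM2l.
have wB : cabs (- herglotz k (r%:C * z)) <= B by rewrite cabsN (le_trans h2)// lerDl.
have pB : cabs (- p.[z]) <= B.
  rewrite cabsN -[p.[z]](subrK (herglotz k (r%:C * z))).
  apply: le_trans (cabsD _ _) _; rewrite addrC lerD//.
  by rewrite cabsB (le_trans h1)// /d ge_min lexx.
rewrite horner_exp hornerD hornerZ hornerN hornerC.
apply: le_trans (cexp_euler pB wB nB) _.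
have hd : cabs (- p.[z] - - herglotz k (r%:C * z)) <= eta / (2 * expR B).
  by rewrite opprK addrC (le_trans h1)// /d ge_min lexx orbT.
apply: le_trans (ler_wpM2l (ltW E0) (lerD hd nd)) _.
by rewrite le_eqVlt; apply/orP; left; apply/eqP; field; rewrite gt_eqF.
Qed.

End Herglotz.
(** * Cyclicity of outer functions *)

Section Outer.
Variable R : realType.
Local Notation m := (circle_measure R).
Local Notation T := (measurableTypeR R).
Local Notation cp := (@circle_point R).
Implicit Types (f g h u : R -> R[i]) (k : R -> R) (z w : R[i]).

(** Dominated convergence: the integrand is at most [|k|] and vanishes at [t] as soon as [n] exceeds
    [- k t]. *)
Lemma truncate_approx k (e : R) : rintegrable k -> 0 < e ->
  exists n : nat, \int[m]_t (Num.max (k t) (- n%:R) - k t) <= e.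
Proof.
move=> ki e0; have mk := rintegrable_measurable ki.
pose f_ (n : nat) (t : R) : R := Num.max (k t) (- n%:R) - k t.
have mf n : measurable_fun [set: T] (f_ n).
  by apply: measurable_funB => //; apply: measurable_maxr => //; exact: measurable_cst.
have f0 n t : 0 <= f_ n t by rewrite subr_ge0 le_max lexx.
have fk n t : `|f_ n t| <= `|k t|.
  rewrite ger0_norm// /f_ /Num.max; case: ifPn => [kn|_]; last by rewrite subrr.
  have n0 : 0 <= n%:R :> R by [].
  by rewrite ltr0_norm; lra.
have [||||_ + _] := @dominated_convergence _ _ _ m [set: T] measurableT
    (fun n t => (f_ n t)%:E) (cst 0%E) (fun t => `|k t|%:E)
    (fun n => (measurable_EFinP _ _ ).2 (mf n)).
- exact: measurable_cst.
- apply: aeT => t _; apply: cvg_near_cst.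
  near=> n; rewrite /f_ max_l ?subrr//.
  rewrite lerNl; near: n; exact: nbhs_infty_ger.
- exact: integrable_norm.
- by apply: aeT => t n _; rewrite /= lee_fin.
move=> /fine_cvgP[_] /cvgrPdist_le/(_ _ e0)[N _ /(_ N (leqnn N))] /=.
rewrite sub0r normrN => /(le_trans (ler_norm _)) h; exists N.
apply: le_trans h; rewrite le_eqVlt; apply/orP; left; apply/eqP.
rewrite /Rintegral; congr fine; apply: eq_integral => t _.
by rewrite /= subr0 ger0_norm.
Unshelve. all: by end_near. Qed.

Lemma cabs_cexp_herglotz k w (n : nat) : cabs w < 1 -> rintegrable k ->
  (forall t, - n%:R <= k t) -> cabs (cexp (- herglotz k w)) <= expR n%:R.
Proof.
move=> w1 ki kn; rewrite cabs_cexp ler_expR cReN lerNl.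
exact: Re_herglotz_ge.
Qed.

(** Expansion of [cabs (c - h t) ^+ 2]. The function [h] enters only through a uniform bound and its
    mean, the two quantities known for [Q * p]. *)
Lemma sqnorm_1B (e : R) h c : cmeasurable h -> cabs c = 1 ->
  (forall t, cabs (h t) <= 1 + e) ->
  sqnorm (fun t => c - h t) <= 1 + (1 + e) ^+ 2 - 2 * complex.Re (conjc c * cintegral h).
Proof.
move=> mh c1 h1; have Lh := L2_bounded mh h1.
have Lc := L2B (L2_cst c) Lh; have hi := cintegrableZ (conjc c) (cintegrable_L2 Lh).
have ri : rintegrable (fun t => 1 + (1 + e) ^+ 2 - 2 * complex.Re (conjc c * h t)).
  by apply: rintegrableB; [exact: rintegrable_cst|exact/rintegrableZ/hi.1].
have -> : 1 + (1 + e) ^+ 2 - 2 * complex.Re (conjc c * cintegral h) =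
    \int[m]_t (1 + (1 + e) ^+ 2 - 2 * complex.Re (conjc c * h t)).
  rewrite RintegralB ?rintegral_cst ?RintegralZl//.
  - by rewrite -cintegralZ//; exact: cintegrable_L2.
  - exact: hi.1.
  - exact: rintegrable_cst.
  - exact/rintegrableZ/hi.1.
apply: le_rintegral => // [|t]; first exact: Lc.2.
have h2 : cabs (h t) ^+ 2 <= (1 + e) ^+ 2.
  by rewrite lerXn2r ?nnegrE ?cabs_ge0// (le_trans (cabs_ge0 _) (h1 t)).
have cc : complex.Re c ^+ 2 + complex.Im c ^+ 2 = 1 by rewrite -sqr_cabs c1 expr1n.
move: h2; rewrite !sqr_cabs cReM cReD cImD cReN cImN cReJ cImJ.
move: cc; move: (complex.Re c) (complex.Im c) (complex.Re (h t)) (complex.Im (h t)).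
move=> x y x' y' cc h2.
have -> : (x - x') ^+ 2 + (y - y') ^+ 2 =
  (x ^+ 2 + y ^+ 2) + (x' ^+ 2 + y' ^+ 2) - 2 * (x * x' - - y * y') by ring.
by rewrite cc lerD2r lerD2l.
Qed.

Section OuterApproximation.
Variables (U : R[i] -> R[i]) (a : nat -> R[i]) (c : R[i]) (k : R -> R).
Hypothesis Ua : expands U a.
Hypothesis c1 : cabs c = 1.
Hypothesis ki : rintegrable k.
Hypothesis UE : forall z, cabs z < 1 -> U z = c * cexp (herglotz k z).

(* [Q] approximates the outer function with modulus [min (1 / |u|, e ^ n)],
   dilated by [r], so that [Q U] is nearly bounded by 1 and nearly [c] at 0. *)
Lemma outer_approx_inverse (n : nat) (r e : R) : 0 <= r < 1 -> 0 < e <= 1 ->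
  \int[m]_t (Num.max (k t) (- n%:R) - k t) <= e ->
  exists Q : {poly R[i]}, exists N, forall j, (N <= j)%N ->
    let p := dilate r (taylor a j) in
    [/\ forall z, cabs z <= 1 -> cabs Q.[z] <= expR n%:R + 1,
        forall z, cabs z <= 1 -> cabs (Q.[z] * p.[z]) <= 1 + e &
        1 - 2 * e <= complex.Re (conjc c * (Q.[0] * p.[0]))].
Proof.
move=> r01 /andP[e0 e1] hn; have [r0 r1] := andP r01.
pose k' t := Num.max (k t) (- n%:R).
have k'n t : - n%:R <= k' t by rewrite le_max lexx orbT.
have kk' t : k t <= k' t by rewrite le_max lexx.
have ki' : rintegrable k'.
  have ai : rintegrable (fun t => `|k t|) by exact: integrable_norm.
  apply: (@le_rintegrable _ _ (fun t => `|k t| + n%:R)).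
  - apply: measurable_maxr; first exact: rintegrable_measurable.
    exact: measurable_cst.
  - move=> t; have n0 : 0 <= n%:R :> R by [].
    have := ler_norm (k t); have := normr_ge0 (k t) => k0 kl.
    rewrite ler_norml; apply/andP; split; first by apply: le_trans (k'n t); lra.
    by rewrite ge_max; apply/andP; split; lra.
  - by apply: rintegrableD => //; exact: rintegrable_cst.
pose E z := cexp (- herglotz k' (r%:C * z)).
have rz z : cabs z <= 1 -> cabs (r%:C * z) <= r.
  by move=> z1; rewrite cabsM cabs_real ger0_norm// ler_piMr.
have rz1 z : cabs z <= 1 -> cabs (r%:C * z) < 1.
  by move=> z1; exact: le_lt_trans (rz z z1) r1.
have En z : cabs z <= 1 -> cabs (E z) <= expR n%:R.
  by move=> z1; apply: cabs_cexp_herglotz => //; exact: rz1.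
(* The exponents combine into the Herglotz integral of [k' - k >= 0]. This gives both the bound 1 on
   the modulus and the value at 0. *)
have EUE z : cabs z <= 1 ->
    E z * U (r%:C * z) = c * cexp (- herglotz (fun t => k' t - k t) (r%:C * z)).
  move=> z1; rewrite UE ?rz1// herglotzB ?rz1// mulrCA /E -cexpD; congr (c * cexp _).
  by ring.
have EU z : cabs z <= 1 -> cabs (E z * U (r%:C * z)) <= 1.
  move=> z1; rewrite EUE// cabsM c1 mul1r cabs_cexp cReN -expR0 ler_expR oppr_le0.
  apply: Re_herglotz_ge0; [exact: rz1|exact: rintegrableB|].
  by move=> t; rewrite subr_ge0.
have [N1 hN1] := taylor_uniform Ua r01 ltr01.
(* One unit is the distance from [U] to its Taylor polynomial, the other the distance from [p] to
   [U], so that [B] also bounds [p]. *)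
pose B := coef_norm1 (taylor a N1) + 2.
have B0 : 0 < B by rewrite ltr_wpDl ?coef_norm1_ge0.
have BU z : cabs z <= r -> cabs (U z) + 1 <= B.
  move=> zr; have z1 : cabs z <= 1 := le_trans zr (ltW r1).
  have := cabsD (U z - (taylor a N1).[z]) (taylor a N1).[z]; rewrite subrK.
  have := hN1 N1 (leqnn _) z zr; rewrite cabsB.
  have := cabs_horner (taylor a N1) z1; rewrite /B; lra.
(* The error of [Q] will be multiplied by [p], bounded by [B], and the error of [p] by [E], bounded
   by [expR n%:R]; each product contributes [e / 2]. *)
pose eta := Num.min 1 (e / (2 * B)).
have eta0 : 0 < eta by rewrite /eta lt_min ltr01 divr_gt0// mulr_gt0.
have [Q hQ] := cexp_herglotz_approx ki' r01 eta0.
pose e2 := Num.min 1 (e / (2 * expR n%:R)).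
have e20 : 0 < e2 by rewrite /e2 lt_min ltr01 divr_gt0// mulr_gt0// expR_gt0.
have [N hN] := taylor_uniform Ua r01 e20.
exists Q; exists N => j Nj p.
have pU z : cabs z <= 1 -> cabs (p.[z] - U (r%:C * z)) <= e2.
  by move=> z1; rewrite horner_dilate hN ?rz.
have pB z : cabs z <= 1 -> cabs p.[z] <= B.
  move=> z1; apply: le_trans (BU _ (rz z z1)).
  rewrite -[p.[z]](subrK (U (r%:C * z))) addrC; apply: le_trans (cabsD _ _) _.
  by rewrite lerD2l (le_trans (pU z z1))// /e2 ge_min lexx.
have close z : cabs z <= 1 -> cabs (Q.[z] * p.[z] - E z * U (r%:C * z)) <= e.
  move=> z1.
  have -> : Q.[z] * p.[z] - E z * U (r%:C * z) =
    (Q.[z] - E z) * p.[z] + E z * (p.[z] - U (r%:C * z)) by ring.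
  apply: le_trans (cabsD _ _) _.
  rewrite (cabsM (Q.[z] - E z)) (cabsM (E z)).
  have h1 : cabs (Q.[z] - E z) * cabs p.[z] <= e / (2 * B) * B.
    rewrite ler_pM ?cabs_ge0 ?pB//; apply: le_trans (hQ z z1) _.
    by rewrite /eta ge_min lexx orbT.
  have h2 : cabs (E z) * cabs (p.[z] - U (r%:C * z)) <= expR n%:R * (e / (2 * expR n%:R)).
    rewrite ler_pM ?cabs_ge0 ?En//; apply: le_trans (pU z z1) _.
    by rewrite /e2 ge_min lexx orbT.
  apply: le_trans (lerD h1 h2) _; rewrite le_eqVlt; apply/orP; left; apply/eqP.
  by field; rewrite !gt_eqF ?expR_gt0.
split=> [z z1|z z1|].
- rewrite -[Q.[z]](subrK (E z)) addrC; apply: le_trans (cabsD _ _) _.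
  by rewrite lerD ?En// (le_trans (hQ z z1))// /eta ge_min lexx.
- rewrite -[_ * _](subrK (E z * U (r%:C * z))) addrC.
  by apply: le_trans (cabsD _ _) _; rewrite lerD ?EU ?close.
(* At 0 the Herglotz integral is the plain integral [d <= e], so [conjc c * (E 0 * U 0)] is
   [expR (- d) >= 1 - e]; the second [e] is the error in [close]. *)
have z0 : cabs (0 : R[i]) <= 1 by rewrite cabs0.
have := close 0 z0; rewrite EUE// mulr0 herglotz0.
set d := \int[m]_t _; have d1 : d <= e by [].
rewrite -rmorphN/= cexp_real => hc.
have h1 : 1 - e <= expR (- d).
  by apply: le_trans _ (expR_ge1Dx (- d)); lra.
have h2 : cabs (conjc c * (Q.[0] * p.[0]) - (expR (- d))%:C) <= e.
  have -> : conjc c * (Q.[0] * p.[0]) - (expR (- d))%:C =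
      conjc c * (Q.[0] * p.[0] - c * (expR (- d))%:C).
    have cJ : conjc c * c = 1 by rewrite mulrC -sqr_cabsE c1 expr1n.
    by rewrite mulrBr (mulrA (conjc c) c) cJ mul1r.
  by rewrite cabsM cabs_conj c1 mul1r.
have := ler_Re_cabs (conjc c * (Q.[0] * p.[0]) - (expR (- d))%:C).
rewrite cReD cReN /= ler_norml => /andP[h3 _]; lra.
Qed.

End OuterApproximation.

Lemma cintegral_mul_eq0 f q : cintegrable f ->
  (forall n, cintegral (fun t => f t * cp t ^+ n) = 0) ->
  cintegral (fun t => f t * (q : {poly R[i]}).[cp t]) = 0.
Proof.
move=> fi f0; rewrite cintegral_mul_poly// big1// => i _.
by rewrite f0 mulr0.
Qed.

(* Beurling's theorem in dual form: [c * int phi] is the sum of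
   [int phi (c - Q p)] and [int phi Q (p - u)], with [p] close to [u] in [L2]
   and [Q] as in [outer_approx_inverse]. *)
Lemma outer_cyclic u phi : L2 u -> outer u -> L2 phi ->
  (forall n, cintegral (fun t => phi t * u t * cp t ^+ n) = 0) ->
  cintegral phi = 0.
Proof.
move=> Lu [U [HU bU] [c [k [c1 ki UE]]]] Lphi phi0.
have [[a Ua] _] := HU.
set I := cintegral phi; set A := sqnorm phi; have A0 : 0 <= A by exact: sqnorm_ge0.
(* The bounds [7 * e] and [e] on the two squared norms give [2 * (7 + 1) = 16]; 18 leaves room. *)
suff h (e : R) : 0 < e <= 1 -> cabs I ^+ 2 <= 18 * A * e.
  apply/eqP; rewrite -cabs_eq0 -sqrf_eq0 eq_le sqr_ge0 andbT.
  apply/ler_addgt0Pr => e e0; rewrite add0r.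
  pose e' := Num.min 1 (e / (18 * A + 1)).
  have A1 : 0 < 18 * A + 1 by rewrite ltr_wpDl// mulr_ge0.
  have e'0 : 0 < e' <= 1 by rewrite /e' lt_min ltr01 divr_gt0//= ge_min lexx.
  apply: le_trans (h e' e'0) _.
  apply: (@le_trans _ _ (18 * A * (e / (18 * A + 1)))).
    by rewrite ler_wpM2l ?mulr_ge0// /e' ge_min lexx orbT.
  by rewrite mulrCA ler_piMr ?(ltW e0)// ler_pdivrMr// mul1r lerDl.
move=> e01; have [e0 e1] := andP e01.
have [n hn] := truncate_approx ki e0.
(* [M] bounds [Q] whatever the radius and the degree, so the radius can be chosen to make [u - p]
   small even after multiplication by [Q]. *)
pose M : R := expR n%:R + 1; have M0 : 0 < M by rewrite addr_gt0// expR_gt0.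
have e'0 : 0 < e / M ^+ 2 by rewrite divr_gt0// exprn_gt0.
have [r /andP[r0 r1] [N1 hN1]] := H2_approx_dilate HU bU Lu.1 Ua e'0.
have r01 : 0 <= r < 1 by rewrite (ltW r0).
have [Q [N2 hN2]] := outer_approx_inverse Ua c1 ki UE r01 e01 hn.
pose j := maxn N1 N2; pose p := dilate r (taylor a j).
have [QM Qp1 Q0] := hN2 j (leq_maxr _ _); have hp := hN1 j (leq_maxl _ _).
rewrite -/p in Qp1 Q0 hp.
pose h t := (Q * p).[cp t].
have Lh : L2 h by exact: L2_poly.
have LuQ := L2_mul_poly Q Lu.
have Lch := L2B (L2_cst c) Lh.
have Lup := L2_mul_poly Q (L2B Lu (L2_poly p)).
have X0 : cintegral (fun t => phi t * (Q.[cp t] * u t)) = 0.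
  have -> : (fun t => phi t * (Q.[cp t] * u t)) = fun t => phi t * u t * Q.[cp t].
    by apply/funext => t; ring.
  by apply: cintegral_mul_eq0 => //; exact: cintegrableM.
have cI : c * I = cintegral (fun t => phi t * (c - h t)) -
    cintegral (fun t => phi t * (Q.[cp t] * (u t - p.[cp t]))).
  rewrite -[LHS]subr0 -X0 -cintegralZ; last exact: cintegrable_L2.
  rewrite -!cintegralB; try exact: cintegrableM; last first.
    exact/cintegrableZ/cintegrable_L2.
  by congr cintegral; apply/funext => t; rewrite /h hornerM; ring.
(* Here [1 + (1 + e) ^+ 2 - 2 * (1 - 2 * e)] equals [6 * e + e ^+ 2], and [e <= 1]. *)
have s1 : sqnorm (fun t => c - h t) <= 7 * e.
  apply: le_trans (sqnorm_1B Lh.1 c1 (_ : forall t, cabs (h t) <= 1 + e)) _.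
    by move=> t; rewrite /h hornerM Qp1// cabs_circle_point.
  rewrite cintegral_poly hornerM.
  have : e ^+ 2 <= e by rewrite expr2 ler_piMl ?(ltW e0).
  lra.
have s2 : sqnorm (fun t => Q.[cp t] * (u t - p.[cp t])) <= e.
  have QM' t : cabs Q.[cp t] <= M by rewrite QM ?cabs_circle_point.
  apply: le_trans (le_sqnormM (cmeasurable_poly_circle Q) QM' (L2B Lu (L2_poly p))) _.
  apply: le_trans (ler_wpM2l (sqr_ge0 M) hp) _.
  by rewrite mulrCA mulfV ?mulr1// gt_eqF// exprn_gt0.
have -> : cabs I = cabs (c * I) by rewrite cabsM c1 mul1r.
rewrite cI.
apply: le_trans (sqr_cabsD _ _) _; rewrite cabsN.
have t1 := le_trans (cauchy_schwarz Lphi Lch) (ler_wpM2l A0 s1).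
have t2 := le_trans (cauchy_schwarz Lphi Lup) (ler_wpM2l A0 s2).
have := mulr_ge0 A0 (ltW e0); rewrite -/A in t1 t2 *; lra.
Qed.

End Outer.
(** * Cauchy transforms *)

Section Division.
Variable R : realType.
Local Notation m := (circle_measure R).
Local Notation T := (measurableTypeR R).
Local Notation cp := (@circle_point R).
Implicit Types (f g h u : R -> R[i]) (U : R[i] -> R[i]) (a : nat -> R[i]) (z w : R[i]).

Lemma rintegral_eq0 (f : R -> R) : rintegrable f -> (forall t, 0 <= f t) ->
  \int[m]_t f t = 0 -> \forall t \ae m, f t = 0.
Proof.
move=> fi f0 h; have mf : measurable_fun [set: T] (fun t => (f t)%:E).
  by apply/measurable_EFinP; exact: rintegrable_measurable.
have e : (\int[m]_t `|(f t)%:E| = 0)%E.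
  under eq_integral do rewrite gee0_abs ?lee_fin//.
  by rewrite -[LHS]fineK ?(integrable_fin_num _ fi)//; congr (_%:E).
have := (ae_eq_integral_abs m measurableT mf).1 e.
by apply: aeS => t /(_ I) [].
Qed.

Lemma outer_neq0_ae u : L2 u -> outer u -> \forall t \ae m, u t != 0.
Proof.
(* As [0^-1 = 0], this is the indicator function of the zero set of [u], in a form whose
   measurability is plain arithmetic. *)
move=> Lu ou; pose phi t : R[i] := 1 - u t * (u t)^-1.
have phiE t : phi t = if u t == 0 then 1 else 0.
  by rewrite /phi; case: eqVneq => [->|u0]; rewrite ?mul0r ?subr0// mulfV// subrr.
have mphi : cmeasurable phi.
  apply: cmeasurableB; first exact: cmeasurable_cst.
  by apply: cmeasurableM; [exact: Lu.1|exact/cmeasurableV/Lu.1].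
have phi1 t : cabs (phi t) <= 1.
  by rewrite phiE; case: ifP => _; rewrite ?cabs0 ?cabs1.
have Lphi := L2_bounded mphi phi1.
have phiu0 t : phi t * u t = 0.
  by rewrite phiE; case: eqVneq => [->|_]; rewrite ?mulr0 ?mul0r.
have := outer_cyclic Lu ou Lphi.
have -> : (forall n, cintegral (fun t => phi t * u t * cp t ^+ n) = 0) <-> True.
  split=> // _ n; have -> : (fun t => phi t * u t * cp t ^+ n) = fun=> 0.
    by apply/funext => t; rewrite phiu0 mul0r.
  exact: cintegral_cst.
move=> /(_ I) [] h _.
have := rintegral_eq0 (cintegrable_L2 Lphi).1 _ h.
have ph0 t : 0 <= complex.Re (phi t) by rewrite phiE; case: ifP.
move=> /(_ ph0); apply: aeS => t; rewrite phiE; case: eqVneq => //= _ /eqP.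
by rewrite oner_eq0.
Qed.

Lemma H2P f : H2 f -> L2 f /\ exists U a,
  [/\ hardy2_disc U, boundary_values U f & expands U a].
Proof.
move=> [/LpP Lf [U HU bU]]; split=> //.
by have [[a Ua] _] := HU; exists U, a.
Qed.

Lemma expands_poly (p : {poly R[i]}) : expands (fun z => p.[z]) (fun i => p`_i).
Proof.
apply/expandsP => z z1 e e0; exists (size p) => // n /= pn.
rewrite horner_poly (horner_coef_wide _ pn).
by rewrite subrr cabs0.
Qed.

Lemma H2_poly (p : {poly R[i]}) : H2 (fun t => p.[cp t]).
Proof.
split; first by apply/LpP; exact: L2_poly.
exists (fun z => p.[z]).
  split; first by exists (fun i => p`_i); exact: expands_poly.
  exists (coef_norm1 p ^+ 2) => r r01.
  have L := L2_disc (@expands_poly p) r01; rewrite -sqnorm_EFin// lee_fin.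
  apply: le_sqnorm_cst => [|t]; first exact: L.1.
  by case/andP : r01 => r0 r1; rewrite cabs_horner// cabs_circle_dilate// ltW.
apply: aeT => t; apply/cvgcP => e e0.
pose B := (size p)%:R * coef_norm1 p.
have B0 : 0 < B + 1 by rewrite ltr_wpDl// mulr_ge0 ?coef_norm1_ge0.
near=> r.
have r0 : 0 <= r by near: r; exact: nbhs_left_ge.
have r1 : r < 1 by near: r; exact: nbhs_left_lt.
have r01 : 0 <= r <= 1 by rewrite r0 ltW.
have z1 : cabs (cp t) <= 1 by rewrite cabs_circle_point.
rewrite -horner_dilate cabsB; apply: le_lt_trans (dilate_close p r01 z1) _.
apply: (@le_lt_trans _ _ ((1 - r) * (B + 1))).
  by rewrite ler_wpM2l ?subr_ge0 ?lerDl// ltW.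
rewrite -ltr_pdivlMr// ltrBlDr -ltrBlDl; near: r; apply: nbhs_left_gt.
by rewrite gtrBl divr_gt0.
Unshelve. all: by end_near. Qed.

Lemma H2_circle_pointX n : H2 (fun t => cp t ^+ n).
Proof. by have := H2_poly 'X^n; under eq_fun do rewrite hornerXn. Qed.

Lemma cabs_eq0_small z (C : R) : (forall e : R, 0 < e -> cabs z <= C * e) -> z = 0.
Proof.
move=> h; apply/eqP; rewrite -cabs_eq0 eq_le cabs_ge0 andbT.
apply/ler_addgt0Pr => e e0; rewrite add0r.
have C0 : 0 <= C by have := h 1 ltr01; rewrite mulr1; apply: le_trans; exact: cabs_ge0.
have C1 : 0 < C + 1 by rewrite ltr_wpDl.
have e'0 : 0 < e / (C + 1) by rewrite divr_gt0.
apply: le_trans (h _ e'0) _; rewrite mulrCA ler_piMr ?(ltW e0)//.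
by rewrite ler_pdivrMr// mul1r lerDl.
Qed.

(** Taylor polynomials of [f] converge to [f] in [L2], so powers suffice as test functions. The
    pairing is bilinear, without conjugation. *)
Lemma cintegral_H2_eq0 f psi : H2 f -> L2 psi ->
  (forall n, cintegral (fun t => psi t * cp t ^+ n) = 0) ->
  cintegral (fun t => psi t * f t) = 0.
Proof.
move=> /H2P[Lf [U [a [HU bU Ua]]]] Lpsi h0; apply: (@cabs_eq0_small _ 1) => e e0.
have [N /(_ N (leqnn N))] := cintegral_H2_approx HU bU Lf.1 Ua Lpsi e0.
by rewrite (cintegral_mul_eq0 _ (cintegrable_L2 Lpsi))// subr0 mul1r.
Qed.

Lemma inner_H2_eq0 f psi : H2 f -> L2 psi ->
  (forall n, cintegral (fun t => psi t * conjc (cp t ^+ n)) = 0) ->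
  cintegral (fun t => psi t * conjc (f t)) = 0.
Proof.
move=> Hf Lpsi h0; have Lf := (H2P Hf).1; have Lc := L2_conj Lpsi.
have -> : (fun t => psi t * conjc (f t)) = fun t => conjc (conjc (psi t) * f t).
  by apply/funext => t; rewrite rmorphM/= conjcK.
rewrite cintegral_conj; last exact: cintegrableM.
rewrite cintegral_H2_eq0 ?conjc0// => n.
have -> : (fun t => conjc (psi t) * cp t ^+ n) =
    fun t => conjc (psi t * conjc (cp t ^+ n)).
  by apply/funext => t; rewrite rmorphM/= conjcK.
rewrite cintegral_conj ?h0 ?conjc0//.
by apply: cintegrableM => //; exact/L2_conj/L2_circle_pointX.
Qed.

Lemma H2_moment0 g n : H2 g -> cintegral (fun t => g t * cp t ^+ n.+1) = 0.
Proof.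
move=> Hg; under eq_fun do rewrite mulrC.
apply: cintegral_H2_eq0 => //; first exact: L2_circle_pointX.
by move=> k; under eq_fun do rewrite -exprD; rewrite cintegral_circle_pointX.
Qed.

(** On the circle [conjc (cp t)] is the inverse of [cp t], so the factor is zeta / (zeta - z), the
    Cauchy kernel relative to normalized Lebesgue measure. *)
Definition cauchy_transform f z : R[i] :=
  cintegral (fun t => f t / (1 - z * conjc (cp t))).

Definition fourier_coef f n : R[i] := cintegral (fun t => f t * conjc (cp t ^+ n)).

Lemma L2_cauchy f z : L2 f -> cabs z < 1 -> L2 (fun t => f t / (1 - z * conjc (cp t))).
Proof.
move=> Lf z1; under eq_fun do rewrite mulrC.
apply: (@L2M_bounded _ ((1 - cabs z)^-1)) => // [|t].
  apply: cmeasurableV; apply: cmeasurableB; first exact: cmeasurable_cst.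
  apply: cmeasurableM; first exact: cmeasurable_cst.
  by apply: cmeasurable_conj; exact: cmeasurable_circle_point.
have z0 : 0 < 1 - cabs z by rewrite subr_gt0.
rewrite cabsV lef_pV2 ?posrE ?cabs_1B_ge//.
exact: lt_le_trans (cabs_1B_ge z t).
Qed.

(** Geometric series under the integral: the remainder after [n] terms is [z ^+ n] times the Cauchy
    integrand times a unimodular factor, hence at most [cabs z ^+ n * I]. *)
Lemma expands_cauchy_transform f : L2 f -> expands (cauchy_transform f) (fourier_coef f).
Proof.
move=> Lf; apply/expandsP => z z1 e e0.
have z01 : 0 <= cabs z < 1 by rewrite cabs_ge0.
have Lc := L2_cauchy Lf z1.
pose I := \int[m]_t cabs (f t / (1 - z * conjc (cp t))).
have e20 : 0 < e / 2 by rewrite divr_gt0.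
have [N hN] := near_geometric I z01 e20; exists N => // n /= Nn.
apply: (@le_lt_trans _ _ (e / 2)); last by lra.
apply: le_trans (hN n Nn).
have fi i : cintegrable (fun t => f t * conjc (cp t ^+ i)).
  by apply: cintegrableM => //; exact/L2_conj/L2_circle_pointX.
have -> : (taylor (fourier_coef f) n).[z] =
    cintegral (fun t => f t * \sum_(i < n) (z * conjc (cp t)) ^+ i).
  have -> : (fun t => f t * \sum_(i < n) (z * conjc (cp t)) ^+ i) =
      fun t => \sum_(i < n) z ^+ i * (f t * conjc (cp t ^+ i)).
    apply/funext => t; rewrite mulr_sumr; apply: eq_bigr => i _.
    by rewrite exprMn rmorphXn mulrCA.
  rewrite cintegral_sum => [|i]; last exact: cintegrableZ.
  by rewrite horner_poly; apply: eq_bigr => i _; rewrite cintegralZ// mulrC.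
have gi : cintegrable (fun t => - (z ^+ n) * (f t / (1 - z * conjc (cp t)) * conjc (cp t ^+ n))).
  apply: cintegrableZ; apply: cintegrableM => //; exact/L2_conj/L2_circle_pointX.
have E t : f t * \sum_(i < n) (z * conjc (cp t)) ^+ i - f t / (1 - z * conjc (cp t)) =
  - (z ^+ n) * (f t / (1 - z * conjc (cp t)) * conjc (cp t ^+ n)).
  rewrite geometric_conj// exprMn rmorphXn; ring.
have si : cintegrable (fun t => f t * \sum_(i < n) (z * conjc (cp t)) ^+ i).
  have := cintegrableD gi (cintegrable_L2 Lc).
  by under eq_fun do rewrite -E subrK.
rewrite -cintegralB//; last exact: cintegrable_L2.
under eq_fun do rewrite E.
apply: le_trans (le_cabs_cintegral gi) _.
rewrite /I -RintegralZr//; last exact/cintegrable_cabs/cintegrable_L2.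
apply: le_rintegral => [||t].
- exact: cintegrable_cabs.
- under eq_fun do rewrite mulrC.
  exact/rintegrableZ/cintegrable_cabs/cintegrable_L2.
- by rewrite !cabsM cabsN cabs_conj !cabsX cabs_circle_point expr1n mulr1 mulrC.
Qed.

End Division.

(** * Cauchy transforms in the Hardy space *)

Section DivisionTheorem.
Variable R : realType.
Local Notation m := (circle_measure R).
Local Notation T := (measurableTypeR R).
Local Notation cp := (@circle_point R).
Implicit Types (f g h u : R -> R[i]) (U : R[i] -> R[i]) (a : nat -> R[i]) (z w : R[i]).

(** Cauchy-Schwarz against the partial Fourier sum gives [S ^+ 2 <= sqnorm f * S], to be divided by
    [S]. *)
Lemma bessel f n : L2 f -> \sum_(i < n) cabs (fourier_coef f i) ^+ 2 <= sqnorm f.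
Proof.
move=> Lf; pose p := taylor (fourier_coef f) n; pose S := \sum_(i < n) cabs (fourier_coef f i) ^+ 2.
have Lp := L2_conj (L2_poly p).
have fi i : cintegrable (fun t => f t * conjc (cp t ^+ i)).
  by apply: cintegrableM => //; exact/L2_conj/L2_circle_pointX.
have sp : sqnorm (fun t => conjc p.[cp t]) = S.
  rewrite sqnorm_conj (sqnorm_poly_wide (size_taylor _ n)); apply: eq_bigr => i _.
  by rewrite coef_taylor ltn_ord.
have ip : cintegral (fun t => f t * conjc p.[cp t]) = S%:C.
  have -> : (fun t => f t * conjc p.[cp t]) =
      fun t => \sum_(i < n) conjc (fourier_coef f i) * (f t * conjc (cp t ^+ i)).
    apply/funext => t; rewrite horner_poly rmorph_sum mulr_sumr; apply: eq_bigr => i _.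
    by rewrite rmorphM mulrCA.
  rewrite cintegral_sum => [|i]; last exact: cintegrableZ.
  rewrite /S rmorph_sum; apply: eq_bigr => i _.
  by rewrite cintegralZ// mulrC; exact/esym/sqr_cabsE.
have := cauchy_schwarz Lf Lp; rewrite ip sp cabs_real real_normK ?num_real//.
rewrite -/S; have [->|S0] := eqVneq S 0; first by move=> _; exact: sqnorm_ge0.
have Sp : 0 < S by rewrite lt_neqAle eq_sym S0 sumr_ge0// => i _; exact: sqr_ge0.
by rewrite expr2 ler_pM2r.
Qed.

(** Bessel's inequality bounds the dilated Taylor polynomials by [sqnorm f]; replacing them by the
    transform itself, at distance at most 1, turns the bound into [2 * (sqnorm f + 1)]. *)
Lemma hardy2_cauchy_transform f : L2 f -> hardy2_disc (cauchy_transform f).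
Proof.
move=> Lf; have Ef := expands_cauchy_transform Lf.
split; first by exists (fourier_coef f).
exists (2 * (sqnorm f + 1)) => r r01; have [r0 r1] := andP r01.
have L := L2_disc Ef r01; rewrite -sqnorm_EFin// lee_fin.
have [N hN] := taylor_uniform Ef r01 ltr01.
pose p := dilate r (taylor (fourier_coef f) N).
have sp : sqnorm (fun t => p.[cp t]) <= sqnorm f.
  apply: le_trans (bessel N Lf); rewrite (@sqnorm_poly_wide _ N); last first.
    by rewrite (leq_trans (size_dilate _ _))// size_taylor.
  apply: ler_sum => i _; rewrite coef_dilate coef_taylor ltn_ord cabsM exprMn.
  rewrite cabs_real ger0_norm ?exprn_ge0// ler_piMr ?sqr_ge0//.
  by rewrite -exprM exprn_ile1// ltW.
apply: (@le_trans _ _ (2 * (sqnorm (fun t => p.[cp t]) + 1))); last by lra.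
apply: sqnorm_le_close => [||t]; [exact: L2_poly|exact: L.1|].
by rewrite cabsB horner_dilate hN// cabs_circle_dilate.
Qed.

(* As [zeta - z = zeta (1 - z / zeta)], the difference of
   [zeta ^ n / (1 - z / zeta)] and [z ^ n / (1 - z / zeta)] is a polynomial in
   [zeta] that vanishes at 0. *)
Lemma cauchy_transform_polyM f z (p : {poly R[i]}) : L2 f ->
  (forall n, cintegral (fun t => f t * cp t ^+ n.+1) = 0) -> cabs z < 1 ->
  cintegral (fun t => f t / (1 - z * conjc (cp t)) * p.[cp t]) =
  p.[z] * cauchy_transform f z.
Proof.
move=> Lf f0 z1; have Lc := L2_cauchy Lf z1.
rewrite cintegral_mul_poly; last exact: cintegrable_L2.
rewrite horner_coef mulr_suml; apply: eq_bigr => i _; rewrite -mulrA; congr (_ * _).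
have fi n : cintegrable (fun t => f t * cp t ^+ n).
  exact: cintegrable_mulX (cintegrable_L2 Lf).
have -> : (fun t => f t / (1 - z * conjc (cp t)) * cp t ^+ i) =
    fun t => z ^+ i * (f t / (1 - z * conjc (cp t))) +
      \sum_(j < i) z ^+ j * (f t * cp t ^+ (i.-1 - j).+1).
  apply/funext => t; have d0 := disc_1B_neq0 t z1.
  have e : cp t ^+ i = z ^+ i +
      (1 - z * conjc (cp t)) * \sum_(j < i) z ^+ j * cp t ^+ (i.-1 - j).+1.
    apply/eqP; rewrite addrC -subr_eq; apply/eqP; rewrite subrXX.
    have -> : cp t - z = (1 - z * conjc (cp t)) * cp t.
      by rewrite mulrBl mul1r -mulrA [conjc _ * _]mulrC circle_pointJ mulr1.
    rewrite -mulrA; congr (_ * _); rewrite mulr_sumr; apply: eq_bigr => j _.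
    by rewrite exprS; ring.
  rewrite e mulrDr mulrC; congr (_ + _).
  rewrite mulrA divfK// mulr_sumr; apply: eq_bigr => j _.
  by rewrite mulrCA.
rewrite cintegralD; last 2 first.
- exact/cintegrableZ/cintegrable_L2.
- by apply: cintegrable_sum => j; exact: cintegrableZ.
rewrite cintegralZ; last exact: cintegrable_L2.
rewrite cintegral_sum => [|j]; last exact: cintegrableZ.
by rewrite big1 ?addr0// => j _; rewrite cintegralZ// f0 mulr0.
Qed.

(** Extends [cauchy_transform_polyM] from polynomials to [h]: its Taylor polynomials converge in
    [L2] on the left and at the point [z] on the right, with errors [e] and [e * cabs K]. *)
Lemma cauchy_transformM f h U a z : L2 f ->
  (forall n, cintegral (fun t => f t * cp t ^+ n.+1) = 0) ->
  hardy2_disc U -> boundary_values U h -> cmeasurable h -> expands U a ->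
  cabs z < 1 ->
  cintegral (fun t => f t / (1 - z * conjc (cp t)) * h t) = U z * cauchy_transform f z.
Proof.
move=> Lf f0 HU bU mh Ua z1; have Lc := L2_cauchy Lf z1.
set K := cauchy_transform f z; apply/eqP; rewrite -subr_eq0; apply/eqP.
apply: (@cabs_eq0_small _ _ (1 + cabs K)) => e e0.
have [N1 hN1] := cintegral_H2_approx HU bU mh Ua Lc e0.
have [N2 _ hN2] := (expandsP U a).1 Ua z z1 e e0.
pose N := maxn N1 N2.
have := hN1 N (leq_maxl _ _); rewrite cauchy_transform_polyM// -/K => h1.
have h2 : cabs ((taylor a N).[z] - U z) < e by apply: hN2; exact: leq_maxr.
set X := cintegral _ in h1 *.
have -> : X - U z * K = (X - (taylor a N).[z] * K) + ((taylor a N).[z] - U z) * K by ring.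
apply: le_trans (cabsD _ _) _; rewrite cabsM mulrDl mul1r lerD//.
by rewrite mulrC ler_wpM2l ?cabs_ge0// ltW.
Qed.

(** Cauchy's formula, as the case [f = 1] of [cauchy_transformM]: the Fourier coefficients of 1 are
    1, 0, 0, ..., so its transform is 1. *)
Lemma cauchy_transform_H2 g U a z : hardy2_disc U -> boundary_values U g ->
  cmeasurable g -> expands U a -> cabs z < 1 -> cauchy_transform g z = U z.
Proof.
move=> HU bU mg Ua z1; have L1 := L2_cst (1 : R[i]).
have h0 n : cintegral (fun t => 1 * cp t ^+ n.+1) = 0.
  by under eq_fun do rewrite mul1r; rewrite cintegral_circle_pointX.
have := cauchy_transformM L1 h0 HU bU mg Ua z1.
have -> : cauchy_transform (fun=> 1) z = 1.
  apply/eqP; rewrite -subr_eq0; apply/eqP; apply: (@cabs_eq0_small _ _ 1) => e e0.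
  have [N _ hN] := (expandsP _ _).1 (expands_cauchy_transform L1) z z1 e e0.
  have := hN N.+1 (leqnSn N); rewrite horner_poly.
  have fc i : fourier_coef (fun _ : R => 1 : R[i]) i = (i == 0%N)%:R.
    rewrite -[RHS](cintegral_circle_point_conj R i 0) /fourier_coef.
    by under [in RHS]eq_fun do rewrite expr0.
  rewrite big_ord_recl big1 => [|i _]; last by rewrite fc mul0r.
  by rewrite fc expr0 mulr1 addr0 mul1r cabsB => /ltW.
rewrite mulr1 => <-; congr cintegral; apply/funext => t.
by rewrite mul1r mulrC.
Qed.

End DivisionTheorem.
(** * Toeplitz kernels *)

Section ToeplitzKernels.
Variable R : realType.
Local Notation m := (circle_measure R).
Local Notation T := (measurableTypeR R).
Local Notation cp := (@circle_point R).
Implicit Types (f g h u F G : R -> R[i]) (U : R[i] -> R[i]) (a : nat -> R[i]) (z w : R[i]).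

Lemma L2_ae_le (C : R) f g : cmeasurable f -> L2 g ->
  (\forall t \ae m, cabs (f t) <= C * cabs (g t)) -> L2 f.
Proof.
move=> mf Lg fg; have [mg gi] := Lg; split=> //.
have mE h : cmeasurable h -> measurable_fun [set: T] (fun t => (cabs (h t) ^+ 2)%:E).
  by move=> mh; apply/measurable_EFinP; exact: measurable_sqr_cabs.
apply/integrableP; split; first exact: mE.
have /integrableP[mCg] := rintegrableZ (C ^+ 2) gi; apply: le_lt_trans.
apply: ae_ge0_le_integral => //.
- by apply: measurableT_comp => //; exact: mE.
- by apply: measurableT_comp.
- apply: aeS fg => t h _; rewrite /= lee_fin (ger0_norm (sqr_ge0 _)).
  apply: le_trans _ (ler_norm _); rewrite -exprMn.
  by rewrite lerXn2r ?nnegrE ?cabs_ge0// (le_trans (cabs_ge0 _) h).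
Qed.

Lemma Lp_pinfty_bounded F : Lp +oo%E F ->
  exists C : R, \forall t \ae m, cabs (F t) <= C.
Proof.
move=> [mF]; rewrite /finite_norm unlock /= probability_setT lte01.
set f := (abse \o _)%E => fin.
have [M fM] : exists M : R, (ess_sup m f <= M%:E)%E.
  by move: fin; case: (ess_sup m f) => [M _|//|_]; [exists M|exists 0; exact: leNye].
exists M; move/ess_supP: fM.
by apply: aeS => t; rewrite /f /= lee_fin ger0_norm ?cabs_ge0.
Qed.

Lemma L2_Lp_pinftyM F f : Lp +oo%E F -> L2 f -> L2 (fun t => F t * f t).
Proof.
move=> LF Lf; have [C hC] := Lp_pinfty_bounded LF.
apply: (@L2_ae_le C _ _ _ Lf); first exact: cmeasurableM LF.1 Lf.1.
by apply: aeS hC => t h; rewrite cabsM ler_wpM2r ?cabs_ge0.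
Qed.

(** Membership in [H2] asks for radial limits of the Cauchy transform. They are those of [V / U],
    and exist almost everywhere because [U] tends to [u t], which is nonzero almost everywhere. *)
Lemma H2_div g f u : H2 g -> L2 u -> outer u -> L2 f ->
  (\forall t \ae m, u t * f t = g t) -> H2 f.
Proof.
move=> Hg Lu ou Lf ufg; have [Lg [V [b [HV bV Vb]]]] := H2P Hg.
(* Multiplied by [u] and a power, the integrand becomes [g] times a power of positive exponent,
   whose integral is zero for [g] in [H2]. *)
have f0 n : cintegral (fun t => f t * cp t ^+ n.+1) = 0.
  under eq_fun do rewrite mulrC.
  apply: (outer_cyclic Lu ou); first exact: L2_mulX.
  move=> k; rewrite -(H2_moment0 (n + k) Hg); apply: ae_eq_cintegral.
  - apply: cmeasurableM; last exact: (L2_circle_pointX _ k).1.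
    by apply: cmeasurableM Lu.1; exact: (L2_mulX n.+1 Lf).1.
  - by apply: cmeasurableM; [exact: Lg.1|exact: (L2_circle_pointX _ _).1].
  - apply: aeS ufg => t <- _.
    by rewrite -addSn exprD; ring.
have ou0 := outer_neq0_ae Lu ou.
have [U [HU bU] [c [k [c1 _ UE]]]] := ou.
have [[a Ua] _] := HU.
split; first exact/LpP.
exists (cauchy_transform f); first exact: hardy2_cauchy_transform.
(* Multiplication by [U z] turns the transform of [f] into that of [u * f = g], which is [V z]; [U]
   has no zero in the disc, being an exponential times [c]. *)
have WU z : cabs z < 1 -> cauchy_transform f z = V z / U z.
  move=> z1.
  have U0 : U z != 0.
    by rewrite UE// mulf_neq0 ?cexp_neq0// -cabs_eq0 c1 oner_eq0.
  rewrite -(cauchy_transform_H2 HV bV Lg.1 Vb z1).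
  apply: (mulIf U0); rewrite divfK// mulrC.
  rewrite -(cauchy_transformM Lf f0 HU bU Lu.1 Ua z1).
  have mq : cmeasurable (fun t => (1 - z * conjc (cp t))^-1).
    by have := (L2_cauchy (L2_cst 1) z1).1; under eq_fun do rewrite mul1r.
  apply: ae_eq_cintegral.
  - by apply: cmeasurableM Lu.1; exact: cmeasurableM Lf.1 mq.
  - exact: cmeasurableM Lg.1 mq.
  - by apply: aeS ufg => t <- _; ring.
have all3 : \forall t \ae m, u t * f t = g t /\ u t != 0.
  by apply: aeS2 ufg ou0.
apply: aeS2 (aeS2 (fun t => @conj _ _) bU bV) all3 => t [bUt bVt] [uf u0].
have -> : f t = g t / u t by rewrite -uf mulrAC mulfV// mul1r.
have FF : Filter ((1 : R)^'-) by exact: at_left_proper_filter.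
have /(cvgcP _ _) VU := @cvgc_div R R _ FF (fun r => V (r%:C * cp t))
  (fun r => U (r%:C * cp t)) _ _ u0 bVt bUt.
apply/(cvgcP _ _) => e /VU VUe; near=> r.
have r0 : 0 <= r by near: r; exact: nbhs_left_ge.
have r1 : r < 1 by near: r; exact: nbhs_left_lt.
rewrite WU ?cabs_circle_dilate//; near: r; exact: VUe.
Unshelve. all: by end_near. Qed.

(** Powers suffice as test functions by [inner_H2_eq0]. Orthogonality to [H2] becomes a sequence of
    moment equations, the form in which it is moved between the two symbols below. *)
Lemma ker_toeplitzP G f : L2 (fun t => G t * f t) -> ker_toeplitz G f <->
  H2 f /\ forall n, cintegral (fun t => G t * f t * conjc (cp t ^+ n)) = 0.
Proof.
move=> LGf.
have E h : inner ((G \* f) \- cst 0) h = cintegral (fun t => G t * f t * conjc (h t)).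
  by rewrite /inner; congr cintegral; apply/funext => t /=; rewrite subr0.
split=> [[Hf [_ h0]]|[Hf h0]].
  split; first exact: Hf.
  by move=> n; rewrite -E; apply: h0; exact: H2_circle_pointX.
split; first exact: Hf.
split=> [|h Hh]; last by rewrite E; exact: inner_H2_eq0.
by have := H2_poly (0 : {poly R[i]}); under eq_fun do rewrite horner0.
Qed.

End ToeplitzKernels.

Theorem proposition3p3 (R : realType) (F u : R -> R[i])
  (hF : Lp +oo%E F) (hF0 : ~ (F = cst 0 %[ae circle_measure R]))
  (hu : H2 u) (hout : outer u)
  (hker : exists2 f, ker_toeplitz F f & ~ (f = cst 0 %[ae circle_measure R]))
  (hsub : mulset u (ker_toeplitz F) `<=` @H2 R) :
  mulset u (ker_toeplitz F) = ker_toeplitz (fun t => F t * conjc (u t) / u t)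
  <-> multC (ker_toeplitz F) u /\
      multC (ker_toeplitz (fun t => F t * conjc (u t) / u t)) (fun t => (u t)^-1).
Proof.
set G := fun t => _; pose m := circle_measure R.
have Lu : L2 u := (H2P hu).1; have mu := Lu.1.
have mF := hF.1.
have mG : cmeasurable G.
  by apply: cmeasurableM; [exact: cmeasurableM mF (cmeasurable_conj mu)|exact: cmeasurableV].
(* The factor [conjc u / u] has modulus 1, or 0 where [u] vanishes; hence [G] multiplies [L2] into
   itself because [F] does. *)
have GF t : cabs (G t) <= cabs (F t).
  rewrite /G !cabsM cabs_conj cabsV; have [->|u0] := eqVneq (u t) 0.
    by rewrite cabs0 mulr0 mul0r cabs_ge0.
  by rewrite mulfK// cabs_eq0.
have LG h : L2 h -> L2 (fun t => G t * h t).
  move=> Lh; apply: (@L2_ae_le _ 1 _ (fun t => F t * h t)).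
  - exact: cmeasurableM mG Lh.1.
  - exact: L2_Lp_pinftyM.
  - by apply: aeT => t; rewrite mul1r (cabsM (G t)) (cabsM (F t)) ler_wpM2r ?cabs_ge0.
have mX n : cmeasurable (fun t : R => conjc (circle_point t ^+ n)).
  by apply: cmeasurable_conj; exact: (L2_circle_pointX R n).1.
split=> [E|[_ C2]].
  split=> h; first by move=> /hsub[].
  (* By the assumed equality [g] is [u * f] with [f] in the kernel for [F]. Division by [u] returns
     [f], or 0 where [u] vanishes, so [f] dominates [h]. *)
  move=> [mh [g + hg]]; rewrite -E => -[mg [f [Hf _] gf]].
  apply/LpP; apply: (@L2_ae_le _ 1 _ f) => //; first exact: (H2P Hf).1.
  move/ae_eq_circleP: hg => hg; move/ae_eq_circleP: gf; apply: aeS2 hg => t /= -> ->.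
  have [->|u0] := eqVneq (u t) 0.
    by rewrite invr0 mul0r cabs0 mul1r cabs_ge0.
  by rewrite mulKf// mul1r.
apply/seteqP; split=> [h hK|g Kg].
  have Hh := hsub _ hK; have Lh := (H2P Hh).1.
  have [mh [f Kf /ae_eq_circleP hf]] := hK; have Lf := (H2P Kf.1).1.
  have LFf := L2_Lp_pinftyM hF Lf.
  have [_ f0] := (ker_toeplitzP LFf).1 Kf.
  apply/ker_toeplitzP; first exact: LG.
  split=> // n.
  (* For [h = u * f] the product [G * h] is [F * f * conjc u]. Conjugation turns its moments into
     bilinear pairings of [psi] with [u], and the moments of [psi] vanish because [f] lies in the
     kernel. *)
  pose psi t := conjc (F t * f t) * circle_point t ^+ n.
  have Lpsi : L2 psi.
    by have := L2_mulX n (L2_conj LFf); under eq_fun do rewrite mulrC.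
  have -> : cintegral (fun t => G t * h t * conjc (circle_point t ^+ n)) =
      cintegral (fun t => conjc (psi t * u t)).
    apply: ae_eq_cintegral.
    - by apply: cmeasurableM => //; exact: cmeasurableM mG mh.
    - by apply: cmeasurable_conj; exact: cmeasurableM Lpsi.1 mu.
    - apply: aeS hf => t /= -> _.
      rewrite /psi /G !rmorphM/= !conjcK; have [->|u0] := eqVneq (u t) 0.
        by rewrite conjc0 !(mulr0, mul0r).
      by field.
  rewrite cintegral_conj; last exact: cintegrableM.
  rewrite cintegral_H2_eq0 ?conjc0// => j.
  have -> : (fun t => psi t * circle_point t ^+ j) =
      fun t => conjc (F t * f t * conjc (circle_point t ^+ (n + j))).
    by apply/funext => t; rewrite [RHS]rmorphM/= conjcK exprD mulrA.
  rewrite cintegral_conj ?f0 ?conjc0//.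
  by apply: cintegrableM => //; exact/L2_conj/L2_circle_pointX.
have Hg : H2 g := Kg.1; have Lg := (H2P Hg).1.
have [_ g0] := (ker_toeplitzP (LG _ Lg)).1 Kg.
(* Square integrability of this quotient is exactly what the condition on [u^-1] provides. *)
pose f t := (u t)^-1 * g t.
have mf : cmeasurable f by exact: cmeasurableM (cmeasurableV mu) Lg.1.
have Lf : L2 f.
  apply/LpP; apply: C2; split=> //; exists g => //.
  by apply/ae_eq_circleP; exact: aeT.
have ufg : \forall t \ae m, u t * f t = g t.
  by apply: aeS (outer_neq0_ae Lu hout) => t u0; rewrite /f mulVKf.
split; first exact: Lg.1.
exists f; last by apply/ae_eq_circleP; apply: aeS ufg => t /= ->.
have Hf := H2_div Hg Lu hout Lf ufg.
have LFf := L2_Lp_pinftyM hF Lf.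
apply/ker_toeplitzP => //; split=> // n.
(* Conjugates are taken because [G * g] is [F * f * conjc u]: only after conjugation does the factor
   [u] appear, which [outer_cyclic] can remove. *)
have Lpsi := L2_mulX n (L2_conj LFf).
have E1 : (fun t => F t * f t * conjc (circle_point t ^+ n)) =
    fun t => conjc (circle_point t ^+ n * conjc (F t * f t)).
  by apply/funext => t; rewrite [RHS]rmorphM/= conjcK mulrC.
rewrite E1 cintegral_conj; last exact: cintegrable_L2.
rewrite (outer_cyclic Lu hout Lpsi) ?conjc0// => k.
have -> : (fun t => circle_point t ^+ n * conjc (F t * f t) * u t * circle_point t ^+ k) =
    fun t => conjc (G t * g t * conjc (circle_point t ^+ (n + k))).
  apply/funext => t; rewrite /G /f !rmorphM/= !conjcK exprD; ring.
rewrite cintegral_conj ?g0 ?conjc0//.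
by apply: cintegrableM; [exact: LG|exact/L2_conj/L2_circle_pointX].
Qed.
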